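(* Let $M$ be a differentiable manifold of dimension $n\ge 3$, let $\mathscr{C}$ be a conformal structure of metrics of indefinite signature on $M$, and let $\mathscr{P}$ be a projective structure on $M$. If $\mathscr{P}$ and $\mathscr{C}$ are light cone compatible, then they are Weyl compatible; that is, for some $g\in\mathscr{C}$ there exists a differential $1$-form $\varphi$ on $M$ such that the affine connection $\Gamma(g,\varphi)$ of the Weylian metric $[(g,\varphi)]$ belongs to $\mathscr{P}$.
   Context: Manifolds and maps are smooth, of class at least $C^2$. A conformal structure on $M$ is an equivalence class $\mathscr{C}=[g]$ of metric tensors, where $g\sim g'$ if and only if $g'=e^{2f}g$ for some function $f$ on $M$. Geodesics are considered without preferred parametrization: a geodesic of a symmetric linear connection $\Gamma$ is a curve $\gamma$ with $\nabla^{\Gamma}_{\dot\gamma}\dot\gamma$ proportional to $\dot\gamma$ (also called an autoparallel curve). Two symmetric (torsion-free) linear connections are projectively equivalent if their geodesics in this sense coincide; equivalently $\Gamma'^i_{jk}=\Gamma^i_{jk}+\delta^i_j\psi_k+\delta^i_k\psi_j$ for some $1$-form $\psi$. A projective structure $\mathscr{P}=[\Gamma]$ is an equivalence class with respect to this relation. A light-like geodesic of $g$ is a geodesic of the Levi-Civita connection of $g$ whose tangent vectors satisfy $g(\dot\gamma,\dot\gamma)=0$. A projective structure $\mathscr{P}=[\Gamma]$ and a conformal structure $\mathscr{C}=[g]$ are called light cone compatible if every light-like geodesic of $g$ is a geodesic (autoparallel curve) of $\Gamma$. This condition does not depend on the choice of the representatives $\Gamma\in\mathscr{P}$ and $g\in\mathscr{C}$.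 A Weylian metric on $M$ is an equivalence class $[(g,\varphi)]$ of pairs consisting of a (semi-)Riemannian metric $g$ and a real-valued differential $1$-form $\varphi$ on $M$, where equivalence is given by $g\mapsto \tilde g=\Omega^2 g$, $\varphi\mapsto\tilde\varphi=\varphi-d\ln\Omega$ with $\Omega$ a positive function. Its affine connection, which is independent of the representative $(g,\varphi)$, is $$\Gamma(g,\varphi)^i_{jk}=F^i_{jk}+\delta^i_j\varphi_k+\delta^i_k\varphi_j-g_{jk}\varphi^i,$$ where $F$ is the Levi-Civita connection of $g$ and $\varphi^i=g^{ij}\varphi_j$. It is the unique torsion-free connection with $\nabla g+2\varphi\otimes g=0$. $\mathscr{P}$ and $\mathscr{C}$ are called Weyl compatible if for some $g\in\mathscr{C}$ there is a differential $1$-form $\varphi$ with $\Gamma(g,\varphi)\in\mathscr{P}$ (if this holds for some $g\in\mathscr{C}$, it holds for any $g\in\mathscr{C}$). *)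

(* Defs.v *)
From mathcomp Require Import all_boot all_order all_algebra.
From mathcomp Require Import all_classical all_reals all_analysis.

Set Implicit Arguments.
Unset Strict Implicit.
Unset Printing Implicit Defensive.

Import Order.TTheory GRing.Theory Num.Theory.
Import numFieldNormedType.Exports.

Local Open Scope ring_scope.
Local Open Scope classical_set_scope.

(* Differentiability classes: [Some k] stands for C^k and [None] for
   C^infinity.  [reg_sub r s] is the class r - s, with infinity - s = infinity. *)
Definition regularity : Type := option nat.

Definition reg_sub (r : regularity) (s : nat) : regularity :=
  omap (fun k => (k - s)%N) r.

Definition at_least_C2 (r : regularity) : Prop :=
  if r is Some k then (2 <= k)%N else True.

(* Only used for U open in a finite-dimensional V, where the existence and
   continuity of all iterated directional derivatives is the usual C^k. *)
Fixpoint Ck (R : realType) (V W : normedModType R) (k : nat)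
    (U : set V) (f : V -> W) : Prop :=
  (forall x, U x -> {for x, continuous f}) /\
  (if k is k'.+1 then
     (forall v x, U x -> derivable f x v) /\
     (forall v, Ck k' U (fun x => 'D_v f x))
   else True).

Definition Cr (R : realType) (V W : normedModType R) (r : regularity)
    (U : set V) (f : V -> W) : Prop :=
  if r is Some k then Ck k U f else forall k, Ck k U f.

(* The maps [coord] and [point] are total, but only their restrictions to
   [dom] and to the image of [dom] are meaningful. *)
Record chart (R : realType) (n : nat) (M : topologicalType) := Chart {
  dom : set M;
  coord : M -> 'rV[R]_n;
  point : 'rV[R]_n -> M;
  dom_open : open dom;
  img_open : open (coord @` dom);
  coordK : forall p, dom p -> point (coord p) = p;
  coord_continuous : forall p, dom p -> {for p, continuous coord};
  point_continuous : forall x, (coord @` dom) x -> {for x, continuous point} }.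

Definition overlap (R : realType) (n : nat) (M : topologicalType)
    (c d : chart R n M) : set 'rV[R]_n := coord c @` (dom c `&` dom d).

Definition transition (R : realType) (n : nat) (M : topologicalType)
    (c d : chart R n M) : 'rV[R]_n -> 'rV[R]_n := coord d \o point c.

(* A C^r manifold of dimension n, presented by an indexed (not necessarily
   maximal) C^r atlas. *)
Record manifold (R : realType) (n : nat) (r : regularity) := Manifold {
  carrier :> topologicalType;
  carrier_hausdorff : hausdorff_space carrier;
  carrier_second_countable : @second_countable carrier;
  atlas : Type;
  ch : atlas -> chart R n carrier;
  ch_cover : forall p : carrier, exists i, dom (ch i) p;
  ch_compatible : forall i j,
    Cr r (overlap (ch i) (ch j)) (transition (ch i) (ch j)) }.

Definition img (R : realType) (n : nat) (r : regularity) (M : manifold R n r)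
    (i : atlas M) : set 'rV[R]_n := coord (ch i) @` dom (ch i).

Definition partial (R : realType) (n : nat) (W : normedModType R) (a : 'I_n)
    (f : 'rV[R]_n -> W) (x : 'rV[R]_n) : W := 'D_('e_a) f x.

(* Row a, column c: the derivative of the c-th new coordinate with respect to
   the a-th old one. *)
Definition jac (R : realType) (n : nat) (r : regularity) (M : manifold R n r)
    (i j : atlas M) (x : 'rV[R]_n) : 'M[R]_n :=
  \matrix_(a, c) partial a (transition (ch i) (ch j)) x 0 c.

(* Tensor fields and connections are given by their components in every chart,
   as functions of the coordinates, subject to the transformation law on the
   overlaps.  On a C^r manifold metrics are of class C^(r-1), connections of
   class C^(r-2). *)
Record metric (R : realType) (n : nat) (r : regularity) (M : manifold R n r) :=
  Metric {
  gc :> atlas M -> 'rV[R]_n -> 'M[R]_n;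
  gc_regular : forall i, Cr (reg_sub r 1) (img i) (gc i);
  gc_sym : forall i x, img i x -> (gc i x)^T = gc i x;
  gc_nondegenerate : forall i x, img i x -> gc i x \in unitmx;
  gc_law : forall i j x, overlap (ch i) (ch j) x ->
    gc i x =
    jac i j x *m gc j (transition (ch i) (ch j) x) *m (jac i j x)^T }.

Record one_form (R : realType) (n : nat) (r : regularity) (M : manifold R n r) :=
  OneForm {
  fc :> atlas M -> 'rV[R]_n -> 'rV[R]_n;
  fc_regular : forall i, Cr (reg_sub r 2) (img i) (fc i);
  fc_law : forall i j x a, overlap (ch i) (ch j) x ->
    fc i x 0 a =
    \sum_c jac i j x a c * fc j (transition (ch i) (ch j) x) 0 c }.

(* [G i x l a b] is the symbol with upper index l and lower indices a, b at the
   point with coordinates x in the chart i. *)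
Definition symbols (R : realType) (n : nat) (r : regularity)
    (M : manifold R n r) : Type :=
  atlas M -> 'rV[R]_n -> 'I_n -> 'I_n -> 'I_n -> R.

Record connection (R : realType) (n : nat) (r : regularity)
    (M : manifold R n r) := Connection {
  cc :> symbols M;
  cc_regular : forall i l a b,
    Cr (reg_sub r 2) (img i) (fun x => cc i x l a b);
  cc_sym : forall i x l a b, img i x -> cc i x l a b = cc i x l b a;
  cc_law : forall i j x l a b, overlap (ch i) (ch j) x ->
    let tau := transition (ch i) (ch j) in
    \sum_c cc i x c a b * jac i j x c l =
    partial a (partial b tau) x 0 l +
    \sum_d \sum_e cc j (tau x) l d e * jac i j x a d * jac i j x b e }.

Definition kron (R : realType) (n : nat) (i j : 'I_n) : R := (i == j)%:R.

Definition levi_civita (R : realType) (n : nat) (r : regularity)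
    (M : manifold R n r) (g : metric M) : symbols M :=
  fun i x l a b =>
    2^-1 * \sum_m invmx (g i x) l m *
      (partial a (g i) x m b + partial b (g i) x m a - partial m (g i) x a b).

Definition raise (R : realType) (n : nat) (r : regularity)
    (M : manifold R n r) (g : metric M) (phi : one_form M)
    (i : atlas M) (x : 'rV[R]_n) (l : 'I_n) : R :=
  \sum_m invmx (g i x) l m * phi i x 0 m.

Definition weyl_symbols (R : realType) (n : nat) (r : regularity)
    (M : manifold R n r) (g : metric M) (phi : one_form M) : symbols M :=
  fun i x l a b =>
    levi_civita g i x l a b + kron R l a * phi i x 0 b
    + kron R l b * phi i x 0 a - g i x a b * raise g phi i x l.

(* Symbols are compared on the chart images only, values elsewhere being
   meaningless. *)
Definition same_symbols (R : realType) (n : nat) (r : regularity)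
    (M : manifold R n r) (G G' : symbols M) : Prop :=
  forall i x l a b, img i x -> G i x l a b = G' i x l a b.

Definition local_curve (R : realType) (n : nat) (r : regularity)
    (M : manifold R n r) (i : atlas M) (gamma : R -> M) : R -> 'rV[R]_n :=
  coord (ch i) \o gamma.

Definition regular_curve (R : realType) (n : nat) (r : regularity)
    (M : manifold R n r) (J : set R) (gamma : R -> M) : Prop :=
  [/\ open J, is_interval J,
      (forall t, J t -> {for t, continuous gamma}) &
      forall i,
        Ck 2 (J `&` gamma @^-1` dom (ch i)) (local_curve i gamma) /\
        (forall t, J t -> dom (ch i) (gamma t) ->
           derive1 (local_curve i gamma) t != 0)].

(* Components in the chart i of the covariant derivative of the velocity of
   gamma along gamma. *)
Definition acceleration (R : realType) (n : nat) (r : regularity)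
    (M : manifold R n r) (G : symbols M) (i : atlas M) (gamma : R -> M) (t : R) :
    'rV[R]_n :=
  let c := local_curve i gamma in
  \row_l (derive1 (derive1 c) t 0 l +
    \sum_a \sum_b G i (c t) l a b * derive1 c t 0 a * derive1 c t 0 b).

(* Unparametrized geodesics (autoparallel curves): the factor may depend on
   the parameter. *)
Definition geodesic (R : realType) (n : nat) (r : regularity)
    (M : manifold R n r) (G : symbols M) (J : set R) (gamma : R -> M) : Prop :=
  regular_curve J gamma /\
  (forall t, J t -> exists lambda : R,
     forall i, dom (ch i) (gamma t) ->
       acceleration G i gamma t = lambda *: derive1 (local_curve i gamma) t).

Definition light_like_geodesic (R : realType) (n : nat) (r : regularity)
    (M : manifold R n r) (g : metric M) (J : set R) (gamma : R -> M) : Prop :=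
  geodesic (levi_civita g) J gamma /\
  (forall i t, J t -> dom (ch i) (gamma t) ->
     let c := local_curve i gamma in
     derive1 c t *m g i (c t) *m (derive1 c t)^T = 0).

Definition projectively_equivalent (R : realType) (n : nat) (r : regularity)
    (M : manifold R n r) (G G' : connection M) : Prop :=
  forall J gamma, geodesic G J gamma <-> geodesic G' J gamma.

Record projective_structure (R : realType) (n : nat) (r : regularity)
    (M : manifold R n r) := ProjectiveStructure {
  pclass : set (connection M);
  pclassP : exists G, pclass = [set G' | projectively_equivalent G G'] }.

Definition conformally_equivalent (R : realType) (n : nat) (r : regularity)
    (M : manifold R n r) (g g' : metric M) : Prop :=
  exists f : M -> R,
    (forall i, Cr (reg_sub r 1) (img i) (f \o point (ch i) : _ -> R^o)) /\
    (forall i x, img i x -> g' i x = expR (2 * f (point (ch i) x)) *: g i x).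

Record conformal_structure (R : realType) (n : nat) (r : regularity)
    (M : manifold R n r) := ConformalStructure {
  cclass : set (metric M);
  cclassP : exists g, cclass = [set g' | conformally_equivalent g g'] }.

(* Sylvester normal form with p signs +1 followed by q signs -1. *)
Definition has_signature (R : realType) (n : nat) (A : 'M[R]_n) (p q : nat) :
    Prop :=
  (p + q)%N = n /\
  exists2 P : 'M[R]_n, P \in unitmx &
    P *m A *m P^T = diag_mx (\row_(i < n) (if (i < p)%N then 1 else -1)).

Definition indefinite (R : realType) (n : nat) (r : regularity)
    (M : manifold R n r) (g : metric M) : Prop :=
  forall i x, img i x ->
    exists p q : nat, [/\ (0 < p)%N, (0 < q)%N & has_signature (g i x) p q].

(* The condition does not depend on the representatives. *)
Definition light_cone_compatible (R : realType) (n : nat) (r : regularity)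
    (M : manifold R n r) (P : projective_structure M)
    (C : conformal_structure M) : Prop :=
  exists g, cclass C g /\
  exists G, pclass P G /\
    forall J gamma, light_like_geodesic g J gamma -> geodesic G J gamma.

Definition weyl_compatible (R : realType) (n : nat) (r : regularity)
    (M : manifold R n r) (P : projective_structure M)
    (C : conformal_structure M) : Prop :=
  exists g, cclass C g /\
  exists (phi : one_form M) (G : connection M),
    same_symbols (weyl_symbols g phi) G /\ pclass P G.

(* Main.v *)
From HB Require Import structures.
Require Import Defs.
From mathcomp Require Import all_boot all_order all_algebra.
From mathcomp Require Import all_classical all_reals all_analysis.
From mathcomp Require Import ring lra.

Set Implicit Arguments.
Unset Strict Implicit.
Unset Printing Implicit Defensive.

Import Order.TTheory GRing.Theory Num.Theory.
Import numFieldNormedType.Exports.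
Import Defs.

Local Open Scope ring_scope.
Local Open Scope classical_set_scope.

(* A light-like geodesic starts in every null direction: the metric is only
   C^1, so the geodesic equation has merely continuous coefficients and one needs
   Peano's theorem.  Since such a geodesic is autoparallel for a connection Gamma
   of the projective class, the difference tensor D of Gamma and the Levi-Civita
   connection satisfies D(v,v) = lambda v for every null vector v.  For an
   indefinite form in dimension at least 3 this forces
   D(u,w) = psi(u) w + psi(w) u - g(u,w) xi.  With phi the 1-form dual to xi, the
   Weyl connection of (g,phi) differs from Gamma by the projective change with
   1-form phi - psi.  Both psi and phi are combinations of the two traces of D,
   which gives their regularity and their transformation law. *)

(** * Peano existence theorem *)

(** Existence of light-like geodesics is enough, uniqueness is never called upon: one curve through
    each null vector [v] suffices, because at time 0 the two geodesic equations share the second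
    derivative of the curve, and subtracting them isolates D(v,v). That the curve stays light-like
    comes from the metricity of the Levi-Civita symbols. A geodesic has to satisfy its equation in
    every chart while it is built in a single one, so the transformation laws of velocity,
    acceleration and Levi-Civita symbols are needed. These rest on the commutation of the second
    derivatives of transition maps, which is drawn from the symmetry of the given connection. The
    algebraic step is linear: three coordinates of mixed sign cut the null cone in a conic with many
    rational points, and coordinates of equal sign are compared through a further one of opposite
    sign. It yields psi and xi one point at a time; their uniqueness is what turns these pointwise
    choices into fields. *)

Section Peano.
Context {R : realType} {V : normedModType R}.
Implicit Types (f : V -> V) (z w : V) (h e B : R).

Definition euler f h (x0 : V) (m : nat) : V := iter m (fun z => z + h *: f z) x0.

(** Each step deviates from the uniform motion of velocity [w] by [h *: (f z - w)], of norm at most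
    [h * e]. With [w = 0] and [e = B] this is the Lipschitz bound; with [w = f (x s)] it is the
    approximate differential equation. *)
Lemma euler_increment f h x0 w e l d : 0 <= h ->
  (forall k, (k < d)%N -> `|f (euler f h x0 (l + k)) - w| <= e) ->
  `|euler f h x0 (l + d) - euler f h x0 l - (d%:R * h) *: w| <= d%:R * h * e.
Proof.
move=> h0; elim: d => [_|d IH H].
  by rewrite addn0 subrr !mul0r scale0r subrr normr0.
have {}IH := IH (fun k kd => H k (leqW kd)).
rewrite addnS /= -/(euler f h x0 (l + d)).
have -> : euler f h x0 (l + d) + h *: f (euler f h x0 (l + d)) - euler f h x0 l -
    (d.+1%:R * h) *: w =
  (euler f h x0 (l + d) - euler f h x0 l - (d%:R * h) *: w) +
   h *: (f (euler f h x0 (l + d)) - w).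
  by rewrite -natr1 mulrDl mul1r scalerDl scalerBr opprD [X in X + _]addrAC addrACA.
apply: le_trans (ler_normD _ _) _.
rewrite -natr1 !mulrDl mul1r lerD// normrZ ger0_norm// ler_wpM2l//.
exact: H.
Qed.

(** Constant between consecutive nodes of mesh 1/(k+1) instead of piecewise linear: the error of one
    mesh step disappears in the limit. *)
Definition euler_step f (x0 : V) (k : nat) (t : R) : V :=
  euler f k.+1%:R^-1 x0 (Num.truncn (t * k.+1%:R)).

Lemma euler_step_between f x0 (k : nat) (s t : R) : 0 <= s <= t ->
  exists l d : nat, [/\ euler_step f x0 k s = euler f k.+1%:R^-1 x0 l,
    euler_step f x0 k t = euler f k.+1%:R^-1 x0 (l + d) &
    `|d%:R * k.+1%:R^-1 - (t - s)| <= k.+1%:R^-1 :> R].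
Proof.
move=> /andP[s0 st]; have k0 : 0 < k.+1%:R :> R by rewrite ltr0n.
exists (Num.truncn (s * k.+1%:R)), (Num.truncn (t * k.+1%:R) - Num.truncn (s * k.+1%:R))%N.
have le_tr : (Num.truncn (s * k.+1%:R) <= Num.truncn (t * k.+1%:R))%N.
  by apply: le_truncn; rewrite ler_pM2r.
split => //; first by rewrite subnKC.
have [] := (truncn_itv (mulr_ge0 s0 (ltW k0)), truncn_itv (mulr_ge0 (le_trans s0 st) (ltW k0))).
move=> /andP[s1 s2] /andP[t1 t2].
rewrite natrB//.
have -> : (t - s) = (t * k.+1%:R - s * k.+1%:R) * k.+1%:R^-1.
  by rewrite -mulrBl mulfK// gt_eqF.
rewrite -mulrBl normrM [X in _ * X]gtr0_norm ?invr_gt0//.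
rewrite -[X in _ < X]natr1 in s2; rewrite -[X in _ < X]natr1 in t2.
apply: ler_piMl; first by rewrite invr_ge0 ltW.
by rewrite ler_norml; apply/andP; split; lra.
Qed.

(** Compactness gives a cluster point of the image filter, and an ultrafilter converges to each of
    its cluster points since it contains every set or its complement. One ultrafilter serves all
    times at once, which replaces the extraction of subsequences. *)
Lemma compact_ultra_cvg (T : Type) (F : set_system T) (K : set V) (u : T -> V) :
  UltraFilter F -> compact K -> (forall k, K (u k)) -> exists z, u @ F --> z.
Proof.
move=> FU Kc Ku.
have FP : ProperFilter F by exact: ultra_proper.
have uK : (u @ F) K by rewrite /nbhs/=; apply: filterS filterT => k _; exact: Ku.
have [z [_ Hz]] := Kc (u @ F) _ uK.
exists z => A Az; have [//|FA] := in_ultra_setVsetC (u @^-1` A) FU.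
have /= [y []//] := Hz (~` A) A FA Az.
Qed.

(* The solution is the pointwise limit of the Euler step functions along an
   ultrafilter: being equi-Lipschitz up to the mesh, they satisfy the differential
   equation approximately, and this estimate only uses the continuity of f at the
   limit point. *)
Lemma peano_half f x0 B : continuous f -> (forall z, `|f z| <= B) ->
  (forall r : R, exists2 K, compact K & forall z, `|z - x0| <= r -> K z) ->
  exists x : R -> V, x 0 = x0 /\ forall s, 0 <= s -> forall e, 0 < e ->
    exists2 d, 0 < d & forall t, 0 <= t -> `|t - s| <= d ->
      `|x t - x s - (t - s) *: f (x s)| <= e * `|t - s|.
Proof.
move=> fc fB cptV.
have B0 : 0 <= B by exact: le_trans (fB x0).
have [F [FU Foo]] := ultraFilterLemma (F := \oo%classic : set_system nat) _.
have FP : ProperFilter F by exact: ultra_proper.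
have [x Hx] : exists x : R -> V, forall t, 0 <= t ->
    euler_step f x0 ^~ t @ F --> x t.
  suff H : forall t, exists z, 0 <= t -> euler_step f x0 ^~ t @ F --> z.
    by have [y Hy] := choice H; exists y.
  move=> t; have [t0|tN] := leP 0 t; last by exists x0.
  have [K Kc HK] := cptV ((t + 1) * B).
  have [k|z Hz] := @compact_ultra_cvg _ F K (euler_step f x0 ^~ t) FU Kc.
    apply: HK.
    have [l [d [El Ed Hd]]] := @euler_step_between f x0 k 0 t (introT andP (conj (lexx 0) t0)).
    have k1 : k.+1%:R^-1 <= 1 :> R by rewrite invf_le1 ?ltr0n// ler1n.
    have -> : x0 = euler f k.+1%:R^-1 x0 0 by [].
    rewrite /euler_step; set m := Num.truncn _.
    have := @euler_increment f k.+1%:R^-1 x0 0 B 0 m.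
    rewrite add0n scaler0 subr0 => /(_ _ _) H.
    apply: le_trans (H _ _) _; first by rewrite invr_ge0.
      by move=> j _; rewrite subr0.
    apply: ler_wpM2r => //.
    have : m%:R <= t * k.+1%:R by rewrite truncn_le// mulr_ge0.
    move=> Hm; rewrite ler_pdivrMr ?ltr0n//; apply: le_trans Hm _.
    by rewrite ler_wpM2r// lerDl.
  by exists z.
have Fsmall e : 0 < e -> F [set k : nat | k.+1%:R^-1 <= e :> R].
  move=> e0; apply: Foo; near=> k; rewrite /=.
  rewrite invf_ple ?posrE ?ltr0n//; apply: le_trans (_ : k%:R <= _); last by rewrite ler_nat.
  by near: k; exact: nbhs_infty_ger.
have Fclose t e : 0 <= t -> 0 < e -> F [set k | `|x t - euler_step f x0 k t| <= e].
  by move=> t0 e0; exact: (cvgrPdist_le _ _).1 (Hx t t0) e e0.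
exists x; split.
  have H0 : euler_step f x0 ^~ 0 @ F --> x0.
    rewrite (_ : euler_step f x0 ^~ 0 = fun=> x0); first exact: cvg_cst.
    by apply/funext => k; rewrite /euler_step mul0r truncn0.
  exact: cvg_unique (Hx 0 (lexx _)) H0.
move=> s s0 e e0.
have [n n0 Hn] : exists2 n, 0 < n & forall z, `|z - x s| <= n -> `|f z - f (x s)| <= e.
  have /cvgrPdist_le/(_ e e0)/nbhs_ballP[n /= n0 Hn] := fc (x s).
  exists (n / 2); first by rewrite divr_gt0.
  move=> z zn; rewrite distrC; apply: Hn; rewrite -ball_normE /ball_/= distrC.
  by apply: le_lt_trans zn _; rewrite ltr_pdivrMr// mulr_natr mulr2n ltrDl.
have B1 : 0 < B + 1 by rewrite ltr_wpDl.
exists (n / 4 / (B + 1)); first by rewrite !divr_gt0.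
move=> t t0 tsd; apply/ler_addgt0Pr => e' e'0.
(* The thirds of [e'] absorb the errors at [s], at [t] and of the mesh, [h * (B + e)]. The quarters
   of [n] keep the Euler points within [n] of [x s]: one for the endpoint error, one for the motion
   during [|t - s|], one for a mesh step. *)
pose c := Num.min (n / 4) (e' / 3); pose c' := Num.min (n / 4 / (B + 1)) (e' / 3 / (B + e + 1)).
have Be1 : 0 < B + e + 1 by rewrite ltr_wpDl// addr_ge0// ltW.
have c0 : 0 < c by rewrite lt_min !divr_gt0.
have c'0 : 0 < c' by rewrite lt_min !divr_gt0.
have [k [[Hs Ht] Hk]] := filter_ex (filterI (filterI (Fclose s c s0 c0) (Fclose t c t0 c0))
  (Fsmall c' c'0)).
rewrite /= in Hs Ht Hk.
set h := k.+1%:R^-1 in Hk; have h0 : 0 < h by rewrite invr_gt0 ltr0n.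
have hn : h * B <= n / 4.
  have : h <= n / 4 / (B + 1) by apply: le_trans Hk _; rewrite ge_min lexx.
  rewrite ler_pdivlMr// => H; apply: le_trans H; rewrite ler_wpM2l//; lra.
have he : h * (B + e) <= e' / 3.
  have : h <= e' / 3 / (B + e + 1) by apply: le_trans Hk _; rewrite ge_min lexx orbT.
  rewrite ler_pdivlMr// => H; apply: le_trans H; rewrite ler_wpM2l//; lra.
have tB : `|t - s| * B <= n / 4.
  move: tsd; rewrite ler_pdivlMr// => H; apply: le_trans H; rewrite ler_wpM2l//; lra.
have Hsn : `|x s - euler_step f x0 k s| <= n / 4.
  by apply: le_trans Hs _; rewrite ge_min lexx.
have Hs3 : `|x s - euler_step f x0 k s| <= e' / 3.
  by apply: le_trans Hs _; rewrite ge_min lexx orbT.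
have Ht3 : `|x t - euler_step f x0 k t| <= e' / 3.
  by apply: le_trans Ht _; rewrite ge_min lexx orbT.
suff main : `|euler_step f x0 k t - euler_step f x0 k s - (t - s) *: f (x s)|
    <= e * `|t - s| + e' / 3.
  have -> : x t - x s - (t - s) *: f (x s) =
      (x t - euler_step f x0 k t) - (x s - euler_step f x0 k s) +
      (euler_step f x0 k t - euler_step f x0 k s - (t - s) *: f (x s)).
    by rewrite [- (x s - euler_step _ _ _ _)]opprD [X in _ = X + _]addrACA -opprD subrKA.
  apply: le_trans (ler_normD _ _) _.
  have := ler_normB (x t - euler_step f x0 k t) (x s - euler_step f x0 k s).
  move: main Hs3 Ht3; lra.
(* Written for an ordered pair with [s] at either end, so that it covers both [s <= t] and [t < s];
   the velocity is frozen at [x s] in both cases. *)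
have step (a b : R) : 0 <= a <= b -> `|b - a| = `|t - s| ->
    `|euler_step f x0 k a - x s| <= n / 4 \/ `|euler_step f x0 k b - x s| <= n / 4 ->
  `|euler_step f x0 k b - euler_step f x0 k a - (b - a) *: f (x s)|
    <= e * `|t - s| + e' / 3.
  move=> ab abts Hab; have [l [d [Ea Eb Hd]]] := @euler_step_between f x0 k a b ab.
  have ba : b - a = `|t - s|.
    by rewrite -abts ger0_norm// subr_ge0; case/andP: ab.
  have dh : d%:R * h <= `|t - s| + h.
    by move: Hd; rewrite ba -/h ler_norml => /andP[]; lra.
  have dhB : d%:R * h * B <= n / 2.
    apply: le_trans (_ : (`|t - s| + h) * B <= _); first by rewrite ler_wpM2r.
    by rewrite mulrDl; move: tB hn; lra.
  have incr i j : (i + j <= d)%N ->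
      `|euler f h x0 (l + i + j) - euler f h x0 (l + i)| <= n / 2.
    move=> ijd; have := @euler_increment f h x0 0 B (l + i) j (ltW h0).
    rewrite scaler0 subr0 => H; apply: le_trans (H _) _.
      by move=> m _; rewrite subr0.
    apply: le_trans dhB; rewrite ler_wpM2r// ler_wpM2r ?(ltW h0)// ler_nat.
    by apply: leq_trans ijd; rewrite leq_addl.
  have near_xs m : (m <= d)%N -> `|euler f h x0 (l + m) - x s| <= n.
    move=> md; case: Hab => [|]; rewrite ?Ea ?Eb -/h => Hx0.
    - have := incr 0%N m; rewrite add0n addn0 => /(_ md) Hi.
      have -> : euler f h x0 (l + m) - x s =
        (euler f h x0 (l + m) - euler f h x0 l) + (euler f h x0 l - x s).
        by rewrite addrA subrK.
      by apply: le_trans (ler_normD _ _) _; move: Hi Hx0; lra.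
    - have := incr m (d - m)%N; rewrite subnKC// -addnA subnKC// => /(_ (leqnn d)) Hi.
      have -> : euler f h x0 (l + m) - x s =
        (euler f h x0 (l + d) - x s) - (euler f h x0 (l + d) - euler f h x0 (l + m)).
        by rewrite opprB [RHS]addrC subrKA.
      by apply: le_trans (ler_normB _ _) _; move: Hi Hx0; lra.
  have := @euler_increment f h x0 (f (x s)) e l d (ltW h0).
  move=> /(_ (fun m md => Hn _ (near_xs m (ltnW md)))) H.
  rewrite Ea Eb -/h.
  set u := euler f h x0 (l + d) - _.
  have -> : u - (b - a) *: f (x s) =
     (u - (d%:R * h) *: f (x s)) + (d%:R * h - (b - a)) *: f (x s).
    by rewrite (scalerBl (d%:R * h)) subrKA.
  apply: le_trans (ler_normD _ _) _; rewrite normrZ.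
  have H2 : `|d%:R * h - (b - a)| * `|f (x s)| <= h * B by rewrite ler_pM.
  have H3 : d%:R * h * e <= (`|t - s| + h) * e by rewrite ler_wpM2r// ltW.
  have : h * B + (`|t - s| + h) * e <= e * `|t - s| + e' / 3.
    by move: he; rewrite !mulrDr !mulrDl [e * _]mulrC; lra.
  by move: H H2 H3; rewrite /u; lra.
have Hsn' : `|euler_step f x0 k s - x s| <= n / 4 by rewrite distrC.
have [st|ts] := leP s t.
  by apply: step => //; [rewrite s0 st|left].
rewrite -normrN !opprD !opprK addrC.
have -> : (t - s) *: f (x s) + (- euler_step f x0 k t + euler_step f x0 k s) =
    euler_step f x0 k s - euler_step f x0 k t - (s - t) *: f (x s).
  by rewrite -scaleNr opprB addrC; congr (_ + _); rewrite addrC.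
by apply: step; [rewrite t0 ltW|rewrite distrC|right].
Unshelve. all: by end_near. Qed.

Lemma is_derive_dist (x : R -> V) (s : R) (v : V) :
  (forall e, 0 < e -> exists2 d, 0 < d & forall t, `|t - s| <= d ->
      `|x t - x s - (t - s) *: v| <= e * `|t - s|) ->
  is_derive s 1 x v.
Proof.
move=> H.
have Hcvg : h^-1 *: ((x \o shift s) (h *: 1) - x s) @[h --> (0:R)^'] --> v.
  apply/cvgrPdist_le => e e0; have [d d0 Hd] := H e e0.
  near=> h.
  have hN0 : h != 0 by near: h; exact: nbhs_dnbhs_neq.
  have hd : `|h| <= d by near: h; exact: dnbhs0_le.
  rewrite /= [h%:A]mulr1.
  have := Hd (h + s); rewrite addrK => /(_ hd) Hh.
  rewrite distrC -[X in _ - X](scalerK hN0) -scalerBr normrZ normfV.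
  by rewrite ler_pdivrMl ?normr_gt0// mulrC.
by apply: DeriveDef; [apply/cvg_ex; exists v|exact: cvg_lim Hcvg].
Unshelve. all: by end_near. Qed.

(* The two half-solutions are glued at 0: for negative times one runs the
   equation of the opposite field. *)
Theorem peano f x0 B : continuous f -> (forall z, `|f z| <= B) ->
  (forall r : R, exists2 K, compact K & forall z, `|z - x0| <= r -> K z) ->
  exists x : R -> V, x 0 = x0 /\ forall t : R, is_derive t 1 x (f (x t)).
Proof.
move=> fc fB cptV.
have [xp [xp0 Hp]] := peano_half fc fB cptV.
have fNc : continuous (fun z => - f z) by move=> z; apply: cvgN; exact: fc.
have fNB z : `|- f z| <= B by rewrite normrN.
have [xm [xm0 Hm]] := peano_half fNc fNB cptV.
pose x t := if 0 <= t then xp t else xm (- t).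
have xE t : t <= 0 -> x t = xm (- t).
  rewrite /x; case: (leP 0 t) => // t0 t0'.
  by have -> : t = 0 by [apply/eqP; rewrite eq_le t0 t0']; rewrite oppr0 xp0 xm0.
have Hmm s : s <= 0 -> forall e, 0 < e -> exists2 d, 0 < d & forall t, t <= 0 ->
    `|t - s| <= d -> `|x t - x s - (t - s) *: f (x s)| <= e * `|t - s|.
  move=> s0 e e0; have [|d d0 Hd] := Hm (- s) _ e e0; first by rewrite oppr_ge0.
  exists d => // t t0 ts; rewrite !xE//.
  have := Hd (- t); rewrite oppr_ge0 -opprD normrN => /(_ t0 ts).
  by rewrite scalerN scaleNr opprK.
have Hpp s : 0 <= s -> forall e, 0 < e -> exists2 d, 0 < d & forall t, 0 <= t ->
    `|t - s| <= d -> `|x t - x s - (t - s) *: f (x s)| <= e * `|t - s|.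
  move=> s0 e e0; have [d d0 Hd] := Hp s s0 e e0.
  by exists d => // t t0 ts; rewrite /x t0 s0; exact: Hd.
exists x; split; first by rewrite /x lexx.
move=> s; apply: is_derive_dist => e e0.
have [s0|s0|s0] := ltgtP s 0.
- have [d d0 Hd] := Hmm s (ltW s0) e e0.
  exists (Num.min d (- s)); first by rewrite lt_min d0 oppr_gt0.
  move=> t; rewrite le_min => /andP[td ts]; apply: Hd => //.
  by move: ts; rewrite ler_norml => /andP[]; lra.
- have [d d0 Hd] := Hpp s (ltW s0) e e0.
  exists (Num.min d s); first by rewrite lt_min d0.
  move=> t; rewrite le_min => /andP[td ts]; apply: Hd => //.
  by move: ts; rewrite ler_norml => /andP[]; lra.
- have [|d1 d10 Hd1] := Hmm s _ e e0; first by rewrite s0.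
  have [|d2 d20 Hd2] := Hpp s _ e e0; first by rewrite s0.
  exists (Num.min d1 d2); first by rewrite lt_min d10.
  move=> t; rewrite le_min => /andP[td1 td2].
  by have [t0|/ltW t0] := leP 0 t; [exact: Hd2|exact: Hd1].
Qed.

End Peano.

(** * Peano's theorem for a field continuous on an open set *)

Section LocalPeano.
Context {R : realType} {V : normedModType R}.
Hypothesis balls_compact : forall (z0 : V) (r : R),
  exists2 K, compact K & forall z, `|z - z0| <= r -> K z.

(** The radial retraction onto the closed ball of radius [r]; the maximum in the denominator spares
    a case distinction and makes continuity immediate. *)
Let clamp (z0 : V) (r : R) (z : V) : V := z0 + (r / Num.max r `|z - z0|) *: (z - z0).

Let clamp_id z0 r z : 0 < r -> `|z - z0| <= r -> clamp z0 r z = z.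
Proof.
move=> r0 zr; rewrite /clamp max_l// divff ?gt_eqF// scale1r.
by rewrite addrC subrK.
Qed.

Let clamp_ball z0 r z : 0 < r -> `|clamp z0 r z - z0| <= r.
Proof.
move=> r0; rewrite /clamp addrC addKr normrZ.
have m0 : 0 < Num.max r `|z - z0| by rewrite lt_max r0.
rewrite ger0_norm; last by rewrite divr_ge0// ltW.
rewrite -mulrA; apply: ler_piMr; first exact: ltW.
by rewrite mulrC ler_pdivrMr// mul1r le_max lexx orbT.
Qed.

Let clamp_continuous z0 r : 0 < r -> continuous (clamp z0 r).
Proof.
move=> r0 z; have cB : {for z, continuous (fun y => y - z0)}.
  by apply: cvgB; [exact: cvg_id|exact: cvg_cst].
have m0 : Num.max r `|z - z0| != 0 by rewrite gt_eqF// lt_max r0.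
apply: cvgD; first exact: cvg_cst.
apply: cvgZ => //; apply: cvgM; first exact: cvg_cst.
apply: cvgV => //.
apply: (@continuous_max R V (fun=> r : R^o) (fun y => `|y - z0| : R^o) z); first exact: cvg_cst.
exact: cvg_norm.
Qed.

(** Composing [F] with the retraction onto a closed ball inside [U] makes it globally continuous and
    bounded. By continuity at 0 the solution stays for a short time in that ball, where the
    composite is [F] itself. *)
Lemma peano_local (U : set V) (F : V -> V) z0 : open U -> U z0 ->
  (forall z, U z -> {for z, continuous F}) ->
  exists (T : R) (x : R -> V), [/\ 0 < T, x 0 = z0 &
    forall t : R, `|t| < T -> U (x t) /\ is_derive t 1 x (F (x t))].
Proof.
move=> oU Uz0 cF.
have [r r0 Hr] : exists2 r : R, 0 < r & forall z, `|z - z0| <= r -> U z.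
  have : nbhs z0 U by exact: open_nbhs_nbhs.
  move=> /nbhs_ballP[r /= r0 Hr]; exists (r / 2); first by rewrite divr_gt0.
  move=> z zr; apply: Hr; rewrite -ball_normE /ball_/= distrC; apply: le_lt_trans zr _.
  by rewrite ltr_pdivrMr// mulr_natr mulr2n ltrDl.
pose f := F \o clamp z0 r.
have cf : continuous f.
  move=> z; apply: continuous_comp; first exact: clamp_continuous.
  by apply: cF; apply: Hr; exact: clamp_ball.
have [B fB] : exists B, forall z, `|f z| <= B.
  have [K Kc HK] := balls_compact z0 r.
  have /compact_bounded[B [Br HB]] : compact (f @` K).
    by apply: continuous_compact => //; exact: continuous_subspaceT.
  exists (B + 1) => z; apply: (HB (B + 1)); first by rewrite ltrDl.
  exists (clamp z0 r z); first by apply: HK; exact: clamp_ball.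
  by rewrite /f /= clamp_id//; exact: clamp_ball.
have [x [x0 Dx]] := peano cf fB (balls_compact z0).
have cx : {for (0 : R), continuous x}.
  apply/differentiable_continuous/derivable1_diffP.
  exact: (@ex_derive _ _ _ _ _ _ _ (Dx 0)).
have [T /= T0 HT] : nbhs (0 : R) [set t | `|x 0 - x t| <= r].
  exact: (cvgrPdist_le _ _).1 cx r r0.
exists T, x; split => // t tT.
have xt : `|x t - z0| <= r.
  by rewrite distrC -x0; apply: HT; rewrite /= sub0r normrN.
split; first exact: Hr.
by have := Dx t; rewrite /f /= clamp_id.
Qed.

End LocalPeano.

(** * Maps of class C^k *)

Section Ck_basics.
Context {R : realType} {V W : normedModType R}.
Implicit Types (U : set V) (f g : V -> W) (k : nat).

Lemma Ck_continuous k U f x : Ck k U f -> U x -> {for x, continuous f}.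
Proof. by case: k => [|k] [cf _] Ux; exact: cf. Qed.

Lemma CkS_derivable k U f v x : Ck k.+1 U f -> U x -> derivable f x v.
Proof. by move=> [_ [df _]] Ux; exact: df. Qed.

Lemma CkS_derive k U f v : Ck k.+1 U f -> Ck k U (fun x => 'D_v f x).
Proof. by move=> [_ [_]]; exact. Qed.

Arguments CkS_derivable {k U f} v [x].
Arguments CkS_derive {k U f} v.

Lemma Ck_le k l U f : (l <= k)%N -> Ck k U f -> Ck l U f.
Proof.
elim: l k f => [|l IH] k f; first by move=> _ /Ck_continuous cf; split => // x; exact: cf.
case: k => // k; rewrite ltnS => lk kf; split; first by move=> x; exact: Ck_continuous kf.
by split=> [v x|v]; [exact: CkS_derivable kf|apply: IH (CkS_derive v kf)].
Qed.

Lemma Ck_subset k U U' f : U' `<=` U -> Ck k U f -> Ck k U' f.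
Proof.
move=> sU; elim: k f => [|k IH] f kf; first by split => // x /sU; exact: Ck_continuous kf.
split=> [x /sU|]; first exact: Ck_continuous kf.
by split=> [v x /sU|v]; [exact: CkS_derivable kf|exact: IH (CkS_derive v kf)].
Qed.

(** Since [U] is open, equality on [U] is equality near each of its points, hence carries over to
    derivatives. It allows formulas that make sense on [U] only. *)
Lemma Ck_eq k U f g : open U -> (forall x, U x -> f x = g x) ->
  Ck k U f -> Ck k U g.
Proof.
move=> oU; have nearU x : U x -> \near x, U x by move=> Ux; apply: open_nbhs_nbhs; split.
have near_fg (f1 g1 : V -> W) x : (forall x, U x -> f1 x = g1 x) -> U x -> \near x, f1 x = g1 x.
  by move=> fg Ux; near=> y; apply: fg; near: y; exact: nearU.
have cfg (f1 g1 : V -> W) x : (forall x, U x -> f1 x = g1 x) -> U x ->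
    {for x, continuous f1} -> {for x, continuous g1}.
  move=> fg Ux cf; have H : f1 @ x --> g1 x by rewrite -fg.
  by apply: cvg_trans H; apply: near_eq_cvg; apply: filterS (near_fg _ _ _ fg Ux) => y ->.
elim: k f g => [|k IH] f g fg kf.
  by split=> // x Ux; exact: cfg Ux (Ck_continuous kf Ux).
split=> [x Ux|]; first exact: cfg Ux (Ck_continuous kf Ux).
split=> [v x Ux|v].
  exact: near_eq_derivable (near_fg f g x fg Ux) (CkS_derivable v kf Ux).
by apply: IH (CkS_derive v kf) => x Ux; apply: near_eq_derive; exact: near_fg.
Unshelve. all: by end_near. Qed.

(** Closure properties are proved through this form: a derivative formula valid on [U] is enough,
    and the induction hypothesis then applies to that formula. *)
Lemma CkS_intro k U f (df : V -> V -> W) : open U ->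
  (forall x, U x -> {for x, continuous f}) ->
  (forall v x, U x -> is_derive x v f (df v x)) ->
  (forall v, Ck k U (df v)) -> Ck k.+1 U f.
Proof.
move=> oU cf Df kdf; split=> //; split=> [v x Ux|v];
  first exact: (@ex_derive _ _ _ _ _ _ _ (Df v x Ux)).
by apply: Ck_eq (kdf v) => // x Ux; rewrite (@derive_val _ _ _ _ _ _ _ (Df v x Ux)).
Qed.

Lemma Ck_cst k U (w : W) : Ck k U (fun=> w).
Proof.
elim: k w => [|k IH] w; first by split=> // x _; exact: cvg_cst.
split=> [x _|]; first exact: cvg_cst.
split=> [v x _|v]; first exact: derivable_cst.
rewrite (_ : (fun x => _) = (fun=> 0 : W)); first exact: IH.
by apply/funext => x; exact: derive_cst.
Qed.

Lemma CkD k U f g : open U -> Ck k U f -> Ck k U g -> Ck k U (fun x => f x + g x).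
Proof.
move=> oU; elim: k f g => [|k IH] f g kf kg.
  by split=> // x Ux; apply: cvgD; [exact: Ck_continuous kf Ux|exact: Ck_continuous kg Ux].
apply: (@CkS_intro _ _ _ (fun v x => 'D_v f x + 'D_v g x)) => // [x Ux|v x Ux|v].
- by apply: cvgD; [exact: Ck_continuous kf Ux|exact: Ck_continuous kg Ux].
- by apply: is_deriveD; apply: derivableP;
  [exact: CkS_derivable kf Ux|exact: CkS_derivable kg Ux].
- by apply: IH; exact: CkS_derive.
Qed.

Lemma Ck_sum k U (I : Type) (r : seq I) (P : pred I) (F : I -> V -> W) :
  open U -> (forall i, P i -> Ck k U (F i)) ->
  Ck k U (fun x => \sum_(i <- r | P i) F i x).
Proof.
move=> oU kF; elim: r => [|i r IH].
  apply: Ck_eq (Ck_cst k U 0) => // x _; by rewrite big_nil.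
have [Pi|Pi] := boolP (P i).
  apply: Ck_eq (CkD oU (kF i Pi) IH) => // x _; by rewrite big_cons Pi.
by apply: Ck_eq IH => // x _; rewrite big_cons (negPf Pi).
Qed.

End Ck_basics.
Arguments CkS_derivable {R V W k U f} v [x].
Arguments CkS_derive {R V W k U f} v.
Arguments Ck_cst {R V W} k U w.

Section Ck_scalar.
Context {R : realType} {V : normedModType R}.
Implicit Types (U : set V) (f g : V -> R) (k : nat).

Lemma CkM k U f g : open U -> Ck k U f -> Ck k U g -> Ck k U (fun x => f x * g x).
Proof.
move=> oU; elim: k f g => [|k IH] f g kf kg.
  by split=> // x Ux; apply: cvgM; [exact: Ck_continuous kf Ux|exact: Ck_continuous kg Ux].
apply: (@CkS_intro _ _ _ _ _ _ (fun v x => f x * 'D_v g x + g x * 'D_v f x)) =>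
  // [x Ux|v x Ux|v].
- by apply: cvgM; [exact: Ck_continuous kf Ux|exact: Ck_continuous kg Ux].
- by apply: is_deriveM; apply: derivableP;
  [exact: CkS_derivable kf Ux|exact: CkS_derivable kg Ux].
- by apply: CkD => //; apply: IH; by [exact: CkS_derive|apply: Ck_le (leqnSn k) _].
Qed.

Lemma CkN k U f : open U -> Ck k U f -> Ck k U (fun x => - f x).
Proof.
move=> oU kf; have H := CkM oU (Ck_cst k U (-1 : R)) kf.
by apply: Ck_eq H => // x _; rewrite mulN1r.
Qed.

Lemma CkB k U f g : open U -> Ck k U f -> Ck k U g -> Ck k U (fun x => f x - g x).
Proof. by move=> oU kf kg; apply: CkD => //; exact: CkN. Qed.

(** The derivative of the inverse involves, besides that of [f], only the inverse itself, which is
    C^k by induction. *)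
Lemma CkV k U f : open U -> (forall x, U x -> f x != 0) -> Ck k U f ->
  Ck k U (fun x => (f x)^-1).
Proof.
move=> oU fN0; elim: k => [|k IH] kf.
  by split=> // x Ux; apply: cvgV; [exact: fN0|exact: Ck_continuous kf Ux].
apply: (@CkS_intro _ _ _ _ _ _ (fun v x => - ((f x)^-1 * (f x)^-1) * 'D_v f x)) =>
  // [x Ux|v x Ux|v].
- by apply: cvgV; [exact: fN0|exact: Ck_continuous kf Ux].
- have Df := CkS_derivable v kf Ux.
  apply: DeriveDef; first exact: derivableV (fN0 x Ux) Df.
  by rewrite deriveV ?fN0// expr2 invfM.
- have kV := IH (Ck_le (leqnSn k) kf).
  by apply: CkM (CkS_derive v kf) => //; apply: CkN => //; exact: CkM.
Qed.

Lemma Ck_prod k U (I : Type) (r : seq I) (P : pred I) (F : I -> V -> R) :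
  open U -> (forall i, P i -> Ck k U (F i)) ->
  Ck k U (fun x => \prod_(i <- r | P i) F i x).
Proof.
move=> oU kF; elim: r => [|i r IH].
  apply: Ck_eq (Ck_cst k U (1 : R)) => // x _; by rewrite big_nil.
have [Pi|Pi] := boolP (P i).
  apply: Ck_eq (CkM oU (kF i Pi) IH) => // x _; by rewrite big_cons Pi.
by apply: Ck_eq IH => // x _; rewrite big_cons (negPf Pi).
Qed.

Lemma Ck_det k U n (A : V -> 'M[R]_n) : open U ->
  (forall i j, Ck k U (fun x => A x i j)) -> Ck k U (fun x => \det (A x)).
Proof.
move=> oU kA; apply: Ck_sum => // s _; apply: CkM (Ck_cst _ _ _) _ => //.
by apply: Ck_prod.
Qed.

(** Cramer's formula: an entry of the inverse is a cofactor divided by the determinant. *)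
Lemma Ck_invmx k U n (A : V -> 'M[R]_n) : open U ->
  (forall x, U x -> A x \in unitmx) ->
  (forall i j, Ck k U (fun x => A x i j)) ->
  forall i j, Ck k U (fun x => invmx (A x) i j).
Proof.
move=> oU uA kA i j.
apply: (@Ck_eq _ _ _ _ _ (fun x =>
  (\det (A x))^-1 * ((-1) ^+ (j + i) * \det (row' j (col' i (A x)))))) => //.
  by move=> x Ux; rewrite /invmx uA// !mxE.
apply: CkM => //.
  by apply: CkV => //; [move=> x /uA; rewrite unitmxE unitfE|exact: Ck_det].
apply: CkM (Ck_cst _ _ _) _ => //; apply: Ck_det => // a b.
by apply: Ck_eq (kA (lift j a) (lift i b)) => // x _; rewrite !mxE.
Qed.

End Ck_scalar.

Section Ck_matrix.
Context {R : realType} {V : normedModType R} {m n : nat}.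
Implicit Types (U : set V) (k : nat).

Lemma continuous_mxP (f : V -> 'M[R]_(m, n)) x :
  {for x, continuous f} <-> forall i j, {for x, continuous (fun y => f y i j)}.
Proof.
split=> [cf i j|cf].
  by apply: (@continuous_comp _ _ _ f (fun M : 'M[R]_(m, n) => M i j)) => //;
    exact: matrix_normedtype.coord_continuous.
apply/cvgrPdist_le => e e0; near=> y.
rewrite /Num.Def.normr/= mx_normrE (bigmax_le _ (ltW e0))//= => i _; rewrite !mxE/=.
move: i; near: y; apply: filter_forall => /= i.
exact: ((cvgrPdist_le _ _).1 (cf i.1 i.2)).
Unshelve. all: by end_near. Qed.

Lemma is_derive_mx (f : V -> 'M[R]_(m, n)) x v df :
  (forall i j, is_derive x v (fun y => f y i j) (df i j)) ->
  is_derive x v f (\matrix_(i, j) df i j).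
Proof.
move=> Df; have Hf : derivable f x v by apply/derivable_mxP => i j; exact: ex_derive.
apply: DeriveDef => //; rewrite derive_mx//; apply/matrixP => i j.
by rewrite !mxE derive_val.
Qed.

Lemma derive_coord (f : V -> 'M[R]_(m, n)) x v i j : derivable f x v ->
  'D_v f x i j = 'D_v (fun y => f y i j) x.
Proof. by move=> df; rewrite derive_mx// mxE. Qed.

Lemma Ck_coord k U (f : V -> 'M[R]_(m, n)) i j : open U ->
  Ck k U f -> Ck k U (fun x => f x i j).
Proof.
move=> oU; elim: k f => [|k IH] f kf.
  by split=> // x Ux; exact: (continuous_mxP f x).1 (Ck_continuous kf Ux) i j.
apply: (@CkS_intro _ _ _ _ _ _ (fun v x => 'D_v f x i j)) => // [x Ux|v x Ux|v].
- by exact: (continuous_mxP f x).1 (Ck_continuous kf Ux) i j.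
- have Df := CkS_derivable v kf Ux.
  rewrite derive_coord//; apply: derivableP; exact: (derivable_mxP f x v).1 Df i j.
- exact: IH (CkS_derive v kf).
Qed.

Lemma Ck_mx k U (f : V -> 'M[R]_(m, n)) : open U ->
  (forall i j, Ck k U (fun x => f x i j)) -> Ck k U f.
Proof.
move=> oU; elim: k f => [|k IH] f kf.
  by split=> // x Ux; apply/continuous_mxP => i j; exact: Ck_continuous (kf i j) Ux.
apply: (@CkS_intro _ _ _ _ _ _ (fun v x => \matrix_(i, j) 'D_v (fun x => f x i j) x)) =>
  // [x Ux|v x Ux|v].
- by apply/continuous_mxP => i j; exact: Ck_continuous (kf i j) Ux.
- apply: is_derive_mx => i j; apply: derivableP; exact: CkS_derivable (kf i j) Ux.
- apply: IH => i j; apply: Ck_eq (CkS_derive v (kf i j)) => // x Ux; by rewrite mxE.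
Qed.

End Ck_matrix.

(** * Differentiability of C^1 functions of several variables *)

Section Differentiability.
Context {R : realType}.

(** The sign of [b] is left free because coordinate increments have either sign. *)
Lemma MVT_origin (f df : R -> R) (b : R) :
  (forall s : R, `|s| <= `|b| -> is_derive s 1 f (df s)) ->
  exists2 c, `|c| <= `|b| & f b - f 0 = df c * b.
Proof.
move=> Df; have cf s : `|s| <= `|b| -> {for s, continuous f}.
  move=> sb; apply/differentiable_continuous/derivable1_diffP.
  exact: (@ex_derive _ _ _ _ _ _ _ (Df s sb)).
have [b0|b0] := leP 0 b.
- have [||c cb E] := @MVT_segment R f df 0 b b0.
  + move=> s; rewrite in_itv/= => /andP[s0 sb]; apply: Df.
    by rewrite !ger0_norm// ltW.
  + apply: continuous_in_subspaceT => s; rewrite inE/= in_itv/= => /andP[s0 sb].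
    by apply: cf; rewrite !ger0_norm.
  + exists c; last by rewrite E subr0.
    by move: cb; rewrite in_itv/= => /andP[c0 cb]; rewrite !ger0_norm.
- have [||c cb E] := @MVT_segment R f df b 0 (ltW b0).
  + move=> s; rewrite in_itv/= => /andP[s0 sb]; apply: Df.
    by rewrite !ler0_norm ?lerN2 ltW.
  + apply: continuous_in_subspaceT => s; rewrite inE/= in_itv/= => /andP[s0 sb].
    by apply: cf; rewrite !ler0_norm ?lerN2// ltW.
  + exists c; last by rewrite -opprB E sub0r mulrN opprK.
    by move: cb; rewrite in_itv/= => /andP[c0 cb]; rewrite !ler0_norm ?lerN2// ltW.
Qed.

Lemma is_derive_line (V W : normedModType R) (f : V -> W) (p v : V) (s : R) :
  derivable f (s *: v + p) v ->
  is_derive s 1 (fun t => f (t *: v + p)) ('D_v f (s *: v + p)).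
Proof.
move=> Df; have E : (fun h : R => h^-1 *: (((fun t =>
  f (t *: v + p)) \o shift s) (h *: 1) - f (s *: v + p))) =
    (fun h : R => h^-1 *: ((f \o shift (s *: v + p)) (h *: v) - f (s *: v + p))).
  by apply/funext => h /=; rewrite [h%:A]mulr1 scalerDl addrA.
by apply: DeriveDef; rewrite /derivable /derive E.
Qed.

Lemma coord_le_norm n (h : 'rV[R]_n) (a : 'I_n) : `|h 0 a| <= `|h|.
Proof.
by rewrite [leRHS]/Num.Def.normr/= mx_normrE; apply: (le_bigmax _ _ (0, a)).
Qed.

Lemma norm_le_coord n (h : 'rV[R]_n) (e : R) : 0 <= e ->
  (forall a, `|h 0 a| <= e) -> `|h| <= e.
Proof.
move=> e0 H; rewrite /Num.Def.normr/= mx_normrE (bigmax_le _ e0)//= => -[i a] _ /=.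
by rewrite ord1.
Qed.

(* One moves from x to x + h changing one coordinate at a time. *)
Lemma C1_increment n (U : set 'rV[R]_n) (f : 'rV[R]_n -> R) x (e : R) :
  open U -> Ck 1 U f -> U x -> 0 < e ->
  exists2 d, 0 < d & forall h, `|h| <= d ->
    `|f (h + x) - f x - \sum_a h 0 a * partial a f x| <= n%:R * (e * `|h|).
Proof.
move=> oU f1 Ux e0.
have [d d0 Hd] : exists2 d, 0 < d & forall y, `|y - x| <= d -> U y /\
    forall a, `|partial a f y - partial a f x| <= e.
  have Hn : \forall y \near x, U y /\ forall a, `|partial a f x - partial a f y| <= e.
    near=> y; split; first by near: y; apply: open_nbhs_nbhs; split.
    move=> a; move: a; near: y; apply: filter_forall => a.
    have ca : {for x, continuous (partial a f)} by exact: Ck_continuous (CkS_derive _ f1) Ux.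
    exact: (cvgrPdist_le _ _).1 ca e e0.
  have /nbhs_ballP[d /= d0 Hd] := Hn; exists (d / 2); first by rewrite divr_gt0.
  move=> y yx; have [] := Hd y; last by move=> Uy Ha; split => // a; rewrite distrC.
  rewrite -ball_normE /ball_/= distrC; apply: le_lt_trans yx _.
  by rewrite ltr_pdivrMr// mulr_natr mulr2n ltrDl.
exists d => // h hd.
pose p (k : nat) : 'rV[R]_n := \row_a (x 0 a + if (a < k)%N then h 0 a else 0).
suff H k : (k <= n)%N ->
    `|f (p k) - f x - \sum_(a < n | (a < k)%N) h 0 a * partial a f x| <= k%:R * (e * `|h|).
  have := H n (leqnn n); have -> : p n = h + x.
    by apply/rowP => a; rewrite !mxE ltn_ord addrC.
  rewrite (eq_bigl xpredT)// => a; exact: ltn_ord.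
elim: k => [_|k IH kn].
  rewrite (_ : p 0%N = x); first by rewrite big_pred0// !subrr normr0 mul0r.
  by apply/rowP => a; rewrite !mxE ltn0 addr0.
pose i := Ordinal kn.
have pS (s : R) a : (s *: 'e_i + p k) 0 a - x 0 a =
  if a == i then s else if (a < k)%N then h 0 a else 0.
  rewrite !mxE eqxx/= eq_sym; case: (eqVneq a i) => [->|ai] /=.
    by rewrite ltnn mulr1 addr0 addrK.
  by rewrite mulr0 add0r addrAC subrr add0r.
have pSE : p k.+1 = h 0 i *: 'e_i + p k.
  apply/rowP => a; apply: (addIr (- x 0 a)); rewrite pS mxE addrC addrA addNr add0r.
  by rewrite ltnS leq_eqVlt -val_eqE/=; case: eqVneq => //= E; congr (h 0 _); apply: val_inj.
have near_x (s : R) : `|s| <= `|h 0 i| -> `|(s *: 'e_i + p k) - x| <= d.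
  move=> sh; apply: le_trans hd; apply: norm_le_coord => // a.
  rewrite mxE [X in _ + X]mxE pS; case: ifP => _.
    by apply: le_trans sh _; exact: coord_le_norm.
  by case: ifP => _; [exact: coord_le_norm|rewrite normr0].
have [|c ch E] := @MVT_origin (fun s => f (s *: 'e_i + p k))
    (fun s => partial i f (s *: 'e_i + p k)) (h 0 i).
  move=> s sh; apply: is_derive_line; apply: CkS_derivable f1 _.
  by have [] := Hd _ (near_x s sh).
rewrite (bigD1 i)//= (eq_bigl (fun a : 'I_n => (a < k)%N)); last first.
  by move=> a; rewrite ltnS -val_eqE/= [RHS]ltn_neqAle andbC.
rewrite scale0r add0r in E; rewrite pSE -natr1 mulrDl mul1r.
set S := \sum_(a < n | _) _.
have -> : f (h 0 i *: 'e_i + p k) - f x - (h 0 i * partial i f x + S) =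
   (f (p k) - f x - S) + h 0 i * (partial i f (c *: 'e_i + p k) - partial i f x).
  have -> : f (h 0 i *: 'e_i + p k) = partial i f (c *: 'e_i + p k) * h 0 i + f (p k).
    by rewrite -E subrK.
  ring.
apply: le_trans (ler_normD _ _) _; rewrite lerD ?IH 1?ltnW// normrM mulrC.
by apply: ler_pM; rewrite ?coord_le_norm//; have [_] := Hd _ (near_x c ch).
Unshelve. all: by end_near. Qed.

(** [Ck] speaks of directional derivatives only, while the chain rule needs a differential; the
    candidate is the linear form with the partial derivatives as coefficients. *)
Lemma C1_differentiable n (U : set 'rV[R]_n) (f : 'rV[R]_n -> R) x :
  open U -> Ck 1 U f -> U x -> differentiable f x.
Proof.
move=> oU f1 Ux; pose L (h : 'rV[R]_n) : R := \sum_a h 0 a * partial a f x.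
have Llin : linear L.
  move=> k u v; rewrite /L /GRing.scale/= mulr_sumr -big_split/=; apply: eq_bigr => a _.
  by rewrite !mxE; ring.
pose LM := GRing.isLinear.Build _ _ _ _ _ Llin.
pose LL : {linear 'rV[R]_n -> R} := HB.pack L LM.
have Lc : continuous LL.
  move=> y; apply: (@Ck_continuous _ _ _ 0 setT LL y) => //.
  apply: Ck_sum => [|a _]; first exact: openT.
  apply: CkM (Ck_cst _ _ _); first exact: openT.
  by split => // z _; exact: matrix_normedtype.coord_continuous.
have H : f \o shift x = cst (f x) + LL +o_ (0 : 'rV[R]_n) id.
  apply/eqaddoP => e e0.
  have n1 : 0 < n%:R + 1 :> R by rewrite ltr_wpDl.
  (* The increment estimate carries a factor [n]; dividing [e] by [n + 1] absorbs it and stays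
     meaningful for [n = 0]. *)
  have [d d0 Hd] := C1_increment oU f1 Ux (divr_gt0 e0 n1).
  have Hn : \forall h \near (0 : 'rV[R]_n), `|h| <= d by exact: nbhs0_le.
  apply: filterS Hn => h /Hd.
  rewrite /= -[X in _ -> is_true (`|X| <= _)]/(f (h + x) - (f x + L h)) opprD addrA => Hh.
  apply: le_trans Hh _; rewrite mulrA ler_wpM2r//.
  by rewrite mulrCA ger_pMr// ler_pdivrMr// mul1r lerDl.
apply/diff_locallyP; have E := diff_unique Lc H.
by rewrite E; split.
Qed.

End Differentiability.

(** * The chain rule and composition of C^k maps *)

Section ChainRule.
Context {R : realType}.

(** The inner map is derivable in the direction [v] only, so it is restricted to the line through
    [t] along [v]: in one real variable derivability is differentiability. *)
Lemma is_derive_comp (V V' W : normedModType R) (c : V -> V') (f : V' -> W) t v :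
  derivable c t v -> differentiable f (c t) ->
  is_derive t v (f \o c) ('d f (c t) ('D_v c t)).
Proof.
move=> Dc Df; pose c1 (s : R) := c (s *: v + t).
have c10 : c1 0 = c t by rewrite /c1 scale0r add0r.
have dc1 : differentiable c1 0 by apply/derivable1_diffP; exact: (derivable1P _ _ _).1 Dc.
have df1 : differentiable f (c1 0) by rewrite c10.
have dfc1 : differentiable (f \o c1) 0 by exact: differentiable_comp.
have Dfc : derivable (f \o c) t v.
  by apply: (derivable1P _ _ _).2; apply/derivable1_diffP; exact: dfc1.
have line (W' : normedModType R) (g : V -> W') : derivable g t v ->
    'D_1 (fun s : R => g (s *: v + t)) 0 = 'D_v g t.
  move=> Dg; have := @is_derive_line R V W' g t v 0; rewrite scale0r add0r => /(_ Dg) H.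
  exact: (@derive_val _ _ _ _ _ _ _ H).
apply: DeriveDef => //; rewrite -(line _ (f \o c) Dfc) -(line _ c Dc).
have -> : (fun s : R => (f \o c) (s *: v + t)) = f \o c1 by [].
rewrite deriveE// diff_comp//= c10; congr ('d f _ _).
by rewrite -/c1 deriveE.
Qed.

Lemma is_derive_comp_rV (V : normedModType R) n (c : V -> 'rV[R]_n)
    (f : 'rV[R]_n -> R) t v : derivable c t v -> differentiable f (c t) ->
  is_derive t v (f \o c) (\sum_a 'D_v c t 0 a * partial a f (c t)).
Proof.
move=> Dc Df; have := is_derive_comp Dc Df.
suff -> : 'd f (c t) ('D_v c t) = \sum_a 'D_v c t 0 a * partial a f (c t) by [].
rewrite {1}(row_sum_delta ('D_v c t)) linear_sum; apply: eq_bigr => a _.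
by rewrite linearZ/= /partial [in RHS](@deriveE _ _ _ f).
Qed.

(** The derivative is a sum of products of derivatives of [c] with partial derivatives of [f]
    composed with [c], and the induction hypothesis applies to the latter. *)
Lemma Ck_comp (V : normedModType R) n k (O : set V) (U : set 'rV[R]_n)
    (c : V -> 'rV[R]_n) (f : 'rV[R]_n -> R) :
  open O -> open U -> (forall t, O t -> U (c t)) ->
  Ck k O c -> Ck k U f -> Ck k O (f \o c).
Proof.
move=> oO oU OU; elim: k f => [|k IH] f kc kf.
  split=> // t Ot; apply: continuous_comp; first exact: Ck_continuous kc Ot.
  exact: Ck_continuous kf (OU t Ot).
apply: (@CkS_intro _ _ _ _ _ _ (fun v t => \sum_a 'D_v c t 0 a * (partial a f \o c) t)) =>
  // [t Ot|v t Ot|v].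
- apply: continuous_comp; first exact: Ck_continuous kc Ot.
  exact: Ck_continuous kf (OU t Ot).
- apply: is_derive_comp_rV; first exact: CkS_derivable kc Ot.
  by apply: C1_differentiable oU (Ck_le _ kf) (OU t Ot).
- apply: Ck_sum => // a _; apply: CkM => //.
    by apply: Ck_coord => //; exact: CkS_derive.
  by apply: IH; [exact: Ck_le kc|exact: CkS_derive].
Qed.

Lemma Ck_comp_rV (V : normedModType R) m n k (O : set V) (U : set 'rV[R]_n)
    (c : V -> 'rV[R]_n) (f : 'rV[R]_n -> 'rV[R]_m) :
  open O -> open U -> (forall t, O t -> U (c t)) ->
  Ck k O c -> Ck k U f -> Ck k O (f \o c).
Proof.
move=> oO oU OU kc kf; apply: Ck_mx => // i j.
by apply: (@Ck_comp _ _ _ _ _ _ (fun x => f x i j)) OU kc _ => //; exact: Ck_coord.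
Qed.

End ChainRule.

(** * Tensors preserving the directions of a null cone *)

Section ConeAlgebra.
Context {R : realFieldType}.

(* A cubic form vanishing on the conic x^2 + y^2 = z^2 is determined, modulo the
   equation of the conic, by its values at enough rational points; the arguments are
   the coefficients of the three components of a quadratic map. *)
Lemma conic_vanishing (Ai Ak Aj Bi Bk Bj Ci Ck Cj Di Dk Dj Ei Ek Ej Fi Fk Fj : R)
    (q := fun A B C D E F x y z : R => x ^+ 2 * A + y ^+ 2 * B + z ^+ 2 * C
            + 2 * (x * y) * D + 2 * (x * z) * E + 2 * (y * z) * F)
    (qi := q Ai Bi Ci Di Ei Fi) (qk := q Ak Bk Ck Dk Ek Fk)
    (qj := q Aj Bj Cj Dj Ej Fj) :
  (forall x y z, x ^+ 2 + y ^+ 2 = z ^+ 2 ->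
    [/\ qi x y z * y = qk x y z * x, qi x y z * z = qj x y z * x &
        qk x y z * z = qj x y z * y]) ->
  [/\ [/\ Fi = 0, Ek = 0 & Dj = 0],
      [/\ Bi = - Ci, Ak = - Ck & Aj = Bj],
      [/\ Di = Fj, Ei = Fk & Dk = Ej] &
      [/\ Ai = 2 * Dk + Bi, Bk = 2 * Di + Ak & Cj = 2 * Ei - Aj]].
Proof.
move=> H.
have [Ek0 Ak0 Ei0 Ai0] : [/\ Ek = 0, Ak = - Ck, Aj = 2 * Ei - Cj & Ai = 2 * Ej - Ci].
  have [] := H 1 0 1 ltac:(ring). have [] := H 1 0 (-1) ltac:(ring).
  rewrite /qi /qk /qj /q; clear => *; split; lra.
have [Fi0 Bi0 Fk0 Bk0] : [/\ Fi = 0, Bi = - Ci, Bj = 2 * Fk - Cj & Bk = 2 * Fj - Ck].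
  have [] := H 0 1 1 ltac:(ring). have [] := H 0 1 (-1) ltac:(ring).
  rewrite /qi /qk /qj /q; clear => *; split; lra.
(* At points with a vanishing x or y the coefficients [D] do not show up; the Pythagorean triple 3,
   4, 5 with all its signs gives the remaining relations without any square root. *)
have [Dj0 EF Di0 Dk0] : [/\ Dj = 0, Ei = Fk, Di = Fj & Dk = Ej].
  have [] := H 3 4 5 ltac:(ring). have [] := H 3 4 (-5) ltac:(ring).
  have [] := H 3 (-4) 5 ltac:(ring). have [] := H 3 (-4) (-5) ltac:(ring).
  rewrite /qi /qk /qj /q Ek0 Ak0 Ei0 Ai0 Fi0 Bi0 Fk0 Bk0; clear => *; split; lra.
by clear H; subst; split; split => //; lra.
Qed.

(** * Diagonal forms with coefficients 1 and -1 *)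

Section DiagonalForm.
Variables (n : nat) (eps : 'I_n -> R) (T : 'I_n -> 'I_n -> 'I_n -> R).
Hypothesis Tsym : forall l a b, T l a b = T l b a.

Let quad (x : 'I_n -> R) l := \sum_a \sum_b T l a b * x a * x b.

Hypothesis Tcone : forall x, \sum_a eps a * x a ^+ 2 = 0 ->
  exists lambda, forall l, quad x l = lambda * x l.

Let supp3 (i k j : 'I_n) (x y z : R) (a : 'I_n) : R :=
  if a == i then x else if a == k then y else if a == j then z else 0.

Let sum_supp3 i k j (F : 'I_n -> R) : i != k -> i != j -> k != j ->
  (forall a, a != i -> a != k -> a != j -> F a = 0) ->
  \sum_a F a = F i + F k + F j.
Proof.
move=> ik ij kj F0; rewrite (bigD1 i)//= (bigD1 k)/= 1?eq_sym// (bigD1 j)/=; last first.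
  by rewrite ![j == _]eq_sym ij kj.
by rewrite big1 ?addr0 ?addrA// => a /andP[/andP[ai ak] aj]; exact: F0.
Qed.

Let quad_supp3 i k j x y z l : i != k -> i != j -> k != j ->
  quad (supp3 i k j x y z) l = x ^+ 2 * T l i i + y ^+ 2 * T l k k + z ^+ 2 * T l j j
     + 2 * (x * y) * T l i k + 2 * (x * z) * T l i j + 2 * (y * z) * T l k j.
Proof.
move=> ik ij kj; rewrite /quad (sum_supp3 ik ij kj).
  rewrite !(sum_supp3 ik ij kj).
    rewrite /supp3 !eqxx ![k == i]eq_sym ![j == i]eq_sym ![j == k]eq_sym.
    rewrite (negPf ik) (negPf ij) (negPf kj) /= (Tsym l k i) (Tsym l j i) (Tsym l j k); ring.
  1-3: by move=> a ai ak aj; rewrite /supp3 (negPf ai) (negPf ak) (negPf aj) /= mulr0.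
move=> a ai ak aj; rewrite big1// => b _.
by rewrite /supp3 (negPf ai) (negPf ak) (negPf aj) /= mulr0 mul0r.
Qed.

Let cone_supp3 i k j x y z : i != k -> i != j -> k != j ->
  eps k = eps i -> eps j = - eps i -> x ^+ 2 + y ^+ 2 = z ^+ 2 ->
  exists lambda, forall l, quad (supp3 i k j x y z) l = lambda * supp3 i k j x y z l.
Proof.
move=> ik ij kj ki ji xyz; apply: Tcone; rewrite (sum_supp3 ik ij kj).
  rewrite /supp3 !eqxx ![k == i]eq_sym ![j == i]eq_sym ![j == k]eq_sym.
  rewrite (negPf ik) (negPf ij) (negPf kj) /= ki ji -xyz; ring.
by move=> a ai ak aj; rewrite /supp3 (negPf ai) (negPf ak) (negPf aj) /= expr0n mulr0.
Qed.

(** Up to a global sign the form restricted to these three coordinates is x^2 + y^2 - z^2, so null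
    vectors form the conic above; the unknown factor [lambda] is eliminated by cross
    multiplication. *)
Let conic_triple i k j : i != k -> i != j -> k != j ->
  eps k = eps i -> eps j = - eps i ->
  [/\ [/\ T i k j = 0, T k i j = 0 & T j i k = 0],
      [/\ T i k k = - T i j j, T k i i = - T k j j & T j i i = T j k k],
      [/\ T i i k = T j k j, T i i j = T k k j & T k i k = T j i j] &
      [/\ T i i i = 2 * T k i k + T i k k, T k k k = 2 * T i i k + T k i i &
          T j j j = 2 * T i i j - T j i i]].
Proof.
move=> ik ij kj ki ji; apply: conic_vanishing => x y z xyz.
have [lam Hlam] := cone_supp3 ik ij kj ki ji xyz.
have [Hi Hk Hj] := And3 (Hlam i) (Hlam k) (Hlam j); move: Hi Hk Hj.
rewrite !quad_supp3// /supp3 !eqxx ![k == i]eq_sym ![j == i]eq_sym ![j == k]eq_sym.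
rewrite (negPf ik) (negPf ij) (negPf kj) /= => -> -> ->.
by split; ring.
Qed.

Hypothesis eps_pm1 : forall a, eps a = 1 \/ eps a = -1.

Let eps_cases a b : eps b = eps a \/ eps b = - eps a.
Proof.
by have [->|->] := eps_pm1 a; have [->|->] := eps_pm1 b; rewrite ?opprK; auto.
Qed.

(** Among three signs that are not all equal exactly one is exceptional; permuting the indices puts
    it in last position, as [conic_triple] requires. *)
Let mixed_triple a b c : a != b -> a != c -> b != c ->
  ~ (eps b = eps a /\ eps c = eps a) ->
  [/\ T a b c = 0, eps b * T a b b = eps c * T a c c, T a a b = T c c b &
      T a a a = 2 * T b b a + eps a * eps b * T a b b].
Proof.
move=> ab ac bc mix.
have [ba ca cb] : [/\ b != a, c != a & c != b] by rewrite ![c == _]eq_sym [b == a]eq_sym.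
have := Tsym a b c; have := Tsym b a b; have := Tsym c b c; have := Tsym a a b.
have := Tsym c a b; have := Tsym a c a.
have [eb|eb] := eps_cases a b; have [ec|ec] := eps_cases a c.
- by case: mix.
- have [[? ? ?] [? ? ?] [? ? ?] [? ? ?]] := conic_triple ab ac bc eb ec.
  by rewrite eb ec => *; have [->|->] := eps_pm1 a; split; lra.
- have [[? ? ?] [? ? ?] [? ? ?] [? ? ?]] := conic_triple ac ab cb ec eb.
  by rewrite eb ec => *; have [->|->] := eps_pm1 a; split; lra.
- have ecb : eps c = eps b by rewrite eb ec.
  have eab : eps a = - eps b by rewrite eb opprK.
  have [[? ? ?] [? ? ?] [? ? ?] [? ? ?]] := conic_triple bc ba ca ecb eab.
  by rewrite eb ec => *; have [->|->] := eps_pm1 a; split; lra.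
Qed.

Hypothesis eps_indef : forall a, exists d, eps d = - eps a.

Let eps_neq a b : eps b = - eps a -> a != b.
Proof. by move=> e; apply/eqP => E; move: e; rewrite -E {E}; have [->|->] := eps_pm1 a => ?;
  lra. Qed.

(** For equal signs, take [d] of opposite sign and a null vector supported on [b], [c], [d]: its
    component along [a] is 0, so the quadratic map has vanishing component [a] there. Changing the
    signs of the coordinates 4 and 5 isolates [T a b c]. *)
Let triple_distinct a b c : a != b -> a != c -> b != c -> T a b c = 0.
Proof.
move=> ab ac bc; have [ba ca cb] : [/\ b != a, c != a & c != b].
  by rewrite ![c == _]eq_sym [b == a]eq_sym.
have [[eb ec]|mix] := pselect (eps b = eps a /\ eps c = eps a); last first.
  by have [] := mixed_triple ab ac bc mix.
have [d ed] := eps_indef a.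
have ad := eps_neq ed.
have bd : b != d by apply: eps_neq; rewrite eb.
have cd : c != d by apply: eps_neq; rewrite ec.
have H y z : 3 ^+ 2 + y ^+ 2 = z ^+ 2 ->
    3 ^+ 2 * T a b b + y ^+ 2 * T a c c + z ^+ 2 * T a d d
     + 2 * (3 * y) * T a b c + 2 * (3 * z) * T a b d + 2 * (y * z) * T a c d = 0.
  move=> yz; have [||lam Hl] := @cone_supp3 b c d 3 y z bc bd cd _ _ yz.
  - by rewrite eb.
  - by rewrite eb.
  - have := Hl a; rewrite quad_supp3// /supp3 (negPf ab) (negPf ac) (negPf ad) /= mulr0 => <-;
    ring.
have H1 := H 4 5 ltac:(ring); have H2 := H 4 (-5) ltac:(ring).
have H3 := H (-4) 5 ltac:(ring); have H4 := H (-4) (-5) ltac:(ring); lra.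
Qed.

Hypothesis n3 : (2 < n)%N.

Let third (a b : 'I_n) : exists c : 'I_n, c != a /\ c != b.
Proof.
have [c Hc] : exists c : 'I_n, c \notin pred2 a b.
  apply/existsP; rewrite -[[exists _, _]]negbK negb_exists; apply/negP => /forallP H.
  have : (#|'I_n| <= #|pred2 a b|)%N.
    by apply: subset_leq_card; apply/fintype.subsetP => c _; have := H c; rewrite negbK.
  by rewrite card_ord card2 leqNgt; case: (a == b) => /=; rewrite ?n3// (ltn_trans _ n3).
by exists c; move: Hc; rewrite !inE negb_or => /andP.
Qed.

(** When all three signs agree, both sides are compared with the term of an index [d] of opposite
    sign, since the triples containing [d] are mixed. The same detour gives the next two facts. *)
Let diag_indep a b c : a != b -> a != c -> eps b * T a b b = eps c * T a c c.
Proof.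
move=> ab ac; have [->//|bc] := eqVneq b c.
have [[eb ec]|mix] := pselect (eps b = eps a /\ eps c = eps a); last first.
  by have [] := mixed_triple ab ac bc mix.
have [d ed] := eps_indef a; have ad := eps_neq ed.
have bd : b != d by apply: eps_neq; rewrite eb.
have cd : c != d by apply: eps_neq; rewrite ec.
have mix e : ~ (eps e = eps a /\ eps d = eps a).
  by rewrite ed => -[_]; have [->|->] := eps_pm1 a => ?; lra.
have [_ -> _ _] := mixed_triple ab ad bd (mix b).
by have [_ -> _ _] := mixed_triple ac ad cd (mix c).
Qed.

Let trace_indep a b c : a != b -> c != b -> T a a b = T c c b.
Proof.
move=> ab cb; have [->//|ac] := eqVneq a c.
have bc : b != c by rewrite eq_sym.
have [[eb ec]|mix] := pselect (eps b = eps a /\ eps c = eps a); last first.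
  by have [] := mixed_triple ab ac bc mix.
have [d ed] := eps_indef a; have ad := eps_neq ed.
have bd : b != d by apply: eps_neq; rewrite eb.
have cd : c != d by apply: eps_neq; rewrite ec.
have mix e e' : eps e' = eps a -> ~ (eps e = eps e' /\ eps d = eps e').
  by rewrite ed => -> -[_]; have [->|->] := eps_pm1 a => ?; lra.
have [_ _ -> _] := mixed_triple ab ad bd (mix b a erefl).
by have [_ _ -> _] := mixed_triple cb cd bd (mix b c ec).
Qed.

Let diag_value a b : a != b -> T a a a = 2 * T b b a + eps a * eps b * T a b b.
Proof.
move=> ab; have [eb|eb] := eps_cases a b.
  have [d ed] := eps_indef a; have ad := eps_neq ed.
  have bd : b != d by apply: eps_neq; rewrite eb.
  have mix : ~ (eps b = eps a /\ eps d = eps a).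
    by rewrite ed => -[_]; have [->|->] := eps_pm1 a => ?; lra.
  by have [] := mixed_triple ab ad bd mix.
have [c [ca cb]] := third a b.
have mix : ~ (eps b = eps a /\ eps c = eps a).
  by rewrite eb => -[+ _]; have [->|->] := eps_pm1 a => ?; lra.
by have [] := mixed_triple ab _ _ mix; rewrite 1?eq_sym.
Qed.

Lemma diagonal_cone_tensor : exists psi xi : 'I_n -> R, forall l a b,
  T l a b = (l == a)%:R * psi b + (l == b)%:R * psi a - (eps a *+ (a == b)) * xi l.
Proof.
have [other Ho] : exists other : 'I_n -> 'I_n, forall a, a != other a.
  have H : forall a : 'I_n, exists b : 'I_n, a != b.
    by move=> a; have [c [ca _]] := third a a; exists c; rewrite eq_sym.
  by have [other Ho] := choice H; exists other.
(* By the two independence facts [T a a b] depends only on [b] and [eps a * T l a a] only on [l],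
   for distinct indices; any choice of [other] thus reads off psi and -xi. *)
exists (fun b => T (other b) (other b) b), (fun l =>
  - (eps (other l) * T l (other l) (other l))) => l a b.
have [<-{a}|la] := eqVneq l a; have [<-{b}|lb] := eqVneq l b.
- rewrite (diag_value (Ho l)) !mulr1n; ring.
- rewrite !(mulr0n, mulr1n) (trace_indep lb (_ : other b != b)) 1?eq_sym ?Ho//; ring.
- rewrite [a == l]eq_sym (negPf la) !(mulr0n, mulr1n) Tsym (trace_indep la (_ :
  other a != a)) 1?eq_sym ?Ho//; ring.
have [<-{b lb}|ab] := eqVneq a b; last first.
  by rewrite triple_distinct// !mulr0n; ring.
have := diag_indep la (Ho l); have [->|->] := eps_pm1 a; rewrite !(mulr0n, mulr1n) => E; lra.
Qed.

End DiagonalForm.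

End ConeAlgebra.

(** Sylvester's normal form reduces the claim to a diagonal form: [E] is the tensor in the basis of
    the rows of [P], its upper index being converted by the inverse of [P]. The covector and the
    vector found there are then carried back. *)
Lemma cone_tensor (R : realType) n (g : 'M[R]_n) (D : 'I_n -> 'M[R]_n) p q :
  (2 < n)%N -> (0 < p)%N -> (0 < q)%N -> has_signature g p q ->
  (forall m, (D m)^T = D m) ->
  (forall v : 'rV[R]_n, v *m g *m v^T = 0 ->
     exists lambda, forall m, (v *m D m *m v^T) 0 0 = lambda * v 0 m) ->
  exists psi xi : 'rV[R]_n,
    forall m, D m = ('e_m)^T *m psi + psi^T *m 'e_m - xi 0 m *: g.
Proof.
move=> n3 p0 q0 [pq [P Pu PgP]] Dsym Dcone.
pose eps (i : 'I_n) : R := if (i < p)%N then 1 else -1.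
set Q := invmx P; have PQ : P *m Q = 1%:M by rewrite mulmxV.
have QP : Q *m P = 1%:M by rewrite mulVmx.
have QPT : P^T *m Q^T = 1%:M by rewrite -trmx_mul QP trmx1.
pose E l : 'M[R]_n := \sum_m Q m l *: (P *m D m *m P^T).
have Esym l : (E l)^T = E l.
  rewrite /E linear_sum; apply: eq_bigr => m _.
  by rewrite linearZ/= !trmx_mul trmxK Dsym mulmxA.
have formE (A : 'M[R]_n) (x : 'I_n -> R) :
    ((\row_i x i) *m A *m (\row_i x i)^T) 0 0 = \sum_a \sum_b A a b * x a * x b.
  rewrite mxE exchange_big/=; apply: eq_bigr => b _; rewrite !mxE mulr_suml.
  by apply: eq_bigr => a _; rewrite !mxE [x a * _]mulrC.
have [||||psi' [xi' H]] := @diagonal_cone_tensor R n eps (fun l a b => E l a b) _ _ _ _ n3.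
- by move=> l a b; rewrite -[in LHS]Esym mxE.
- move=> x x0; pose X : 'rV[R]_n := \row_i x i; pose v := X *m P.
  have [|lam Hlam] := Dcone v.
    rewrite /v trmx_mul !mulmxA -[X *m P *m g]mulmxA -[X *m (P *m g) *m _]mulmxA PgP.
    apply/matrixP => i j; rewrite !ord1 formE [RHS]mxE -[RHS]x0; apply: eq_bigr => a _.
    rewrite (bigD1 a)//= big1 ?addr0 => [|b ba];
      last by rewrite !mxE eq_sym (negPf ba) mulr0n !mul0r.
    by rewrite !mxE eqxx mulr1n expr2 mulrA.
  exists lam => l; rewrite -formE -/X /E mulmx_sumr mulmx_suml summxE.
  have -> : x l = \sum_m v 0 m * Q m l.
    by have := mulmxK Pu X => /matrixP /(_ 0 l); rewrite !mxE => <-.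
  rewrite mulr_sumr; apply: eq_bigr => m _.
  rewrite -scalemxAr -scalemxAl mxE mulrA -Hlam /v trmx_mul !mulmxA mulrC.
  by rewrite -!mulmxA.
- by move=> a; rewrite /eps; case: ifP => _; [left|right].
(* The index [p] carries the sign -1 and the index 0 the sign 1. *)
- move=> a; have pn : (p < n)%N by rewrite -pq -[X in (X < _)%N]addn0 ltn_add2l.
  have [ap|ap] := boolP (a < p)%N.
    by exists (Ordinal pn); rewrite /eps /= ltnn ap.
  by exists (Ordinal (ltn_trans p0 pn)); rewrite /eps /= p0 (negPf ap) opprK.
pose psi : 'rV[R]_n := \row_b psi' b; pose xi : 'rV[R]_n := \row_b xi' b.
have EE l : E l = ('e_l)^T *m psi + psi^T *m 'e_l - xi' l *: diag_mx (\row_i eps i).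
  apply/matrixP => a b; rewrite H !mxE !big_ord1 !mxE !eqxx/= ![_ == l]eq_sym.
  by rewrite [psi' a * _]mulrC [xi' l * _]mulrC.
exists (psi *m Q^T), (xi *m P) => m.
have DE : D m = \sum_l P l m *: (Q *m E l *m Q^T).
  transitivity (Q *m (\sum_l P l m *: E l) *m Q^T); last first.
    rewrite mulmx_sumr mulmx_suml; apply: eq_bigr => l _.
    by rewrite -scalemxAr -scalemxAl.
  have -> : \sum_l P l m *: E l = P *m D m *m P^T.
    under eq_bigr do rewrite /E scaler_sumr.
    rewrite exchange_big/= (bigD1 m)//= [X in _ + X]big1 => [|m' m'm].
      under eq_bigr do rewrite scalerA.
      rewrite -scaler_suml addr0; under eq_bigr do rewrite mulrC.
      have := congr1 (fun A : 'M[R]_n => A m m) QP; rewrite !mxE eqxx => ->.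
      by rewrite scale1r.
    under eq_bigr do rewrite scalerA.
    rewrite -scaler_suml; under eq_bigr do rewrite mulrC.
    have := congr1 (fun A : 'M[R]_n => A m' m) QP; rewrite !mxE (negPf m'm) => ->.
    by rewrite scale0r.
  by rewrite !mulmxA QP mul1mx -!mulmxA QPT mulmx1.
have eE : (\sum_l P l m *: ('e_l : 'rV[R]_n)) *m Q^T = 'e_m.
  have -> : \sum_l P l m *: ('e_l : 'rV[R]_n) = 'e_m *m P^T.
    apply/rowP => b; rewrite -rowE !mxE summxE (bigD1 b)//= big1 => [|l lb].
      by rewrite !mxE !eqxx mulr1 addr0.
    by rewrite !mxE eq_sym (negPf lb) mulr0.
  by rewrite -mulmxA QPT mulmx1.
have gE : g = Q *m diag_mx (\row_i eps i) *m Q^T.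
  by rewrite -PgP !mulmxA QP mul1mx -!mulmxA QPT mulmx1.
rewrite DE; under eq_bigr => l _.
  rewrite EE mulmxBr mulmxBl mulmxDr mulmxDl scalerBr scalerDr.
  rewrite -scalemxAr -scalemxAl -gE.
  over.
rewrite sumrB big_split/=; congr (_ + _ - _).
- transitivity ((Q *m \sum_l P l m *: ('e_l : 'rV[R]_n)^T) *m (psi *m Q^T)).
    rewrite mulmx_sumr mulmx_suml; apply: eq_bigr => l _.
    by rewrite -scalemxAr -scalemxAl !mulmxA.
  congr (_ *m _); rewrite -eE trmx_mul trmxK; congr (_ *m _).
  by rewrite linear_sum; apply: eq_bigr => l _; rewrite linearZ.
- rewrite -[in RHS]eE trmx_mul trmxK mulmx_suml mulmx_sumr; apply: eq_bigr => l _.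
  by rewrite -!scalemxAl -scalemxAr !mulmxA.
- rewrite mxE scaler_suml; apply: eq_bigr => l _.
  by rewrite scalerA mxE mulrC.
Qed.

(** * Transformation of the Levi-Civita symbols *)

Section MatrixDerivative.
Context {R : realType} {V : normedModType R}.

Lemma is_derive_sum_fun n (W : normedModType R) (h : 'I_n -> V -> W) x v (dh : 'I_n -> W) :
  (forall i, is_derive x v (h i) (dh i)) ->
  is_derive x v (fun y => \sum_i h i y) (\sum_i dh i).
Proof.
move=> H; rewrite (_ : (fun y => _) = \sum_i h i); first exact: is_derive_sum.
by apply/funext => y; rewrite fct_sumE.
Qed.

Lemma is_derive_mulmx m n p (A : V -> 'M[R]_(m, n)) (B : V -> 'M[R]_(n, p))
    x v dA dB : is_derive x v A dA -> is_derive x v B dB ->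
  is_derive x v (fun y => A y *m B y) (dA *m B x + A x *m dB).
Proof.
move=> HA HB; have DA : derivable A x v by exact: ex_derive.
have DB : derivable B x v by exact: ex_derive.
have DAij i j : is_derive x v (fun y => A y i j) (dA i j).
  have -> : dA = 'D_v A x by apply/esym; exact: derive_val.
  rewrite derive_coord//; apply: derivableP; exact: (derivable_mxP A x v).1 DA i j.
have DBij i j : is_derive x v (fun y => B y i j) (dB i j).
  have -> : dB = 'D_v B x by apply/esym; exact: derive_val.
  rewrite derive_coord//; apply: derivableP; exact: (derivable_mxP B x v).1 DB i j.
have -> : dA *m B x + A x *m dB =
    \matrix_(i, k) \sum_j (A x i j *: dB j k + B x j k *: dA i j).
  apply/matrixP => i k; rewrite !mxE big_split/= addrC; congr (_ + _).
  by apply: eq_bigr => j _; rewrite mulrC.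
apply: is_derive_mx => i k.
rewrite (_ : (fun y => _) = (fun y => \sum_j A y i j * B y j k)); last first.
  by apply/funext => y; rewrite mxE.
by apply: is_derive_sum_fun => j; exact: is_deriveM.
Qed.

Lemma is_derive_trmx m n (A : V -> 'M[R]_(m, n)) x v dA :
  is_derive x v A dA -> is_derive x v (fun y => (A y)^T) dA^T.
Proof.
move=> HA; have DA : derivable A x v by exact: ex_derive.
have -> : dA^T = \matrix_(i, j) dA j i by apply/matrixP => i j; rewrite !mxE.
apply: is_derive_mx => i j.
rewrite (_ : (fun y => _) = (fun y => A y j i)); last by apply/funext => y; rewrite mxE.
have -> : dA = 'D_v A x by apply/esym; exact: derive_val.
rewrite derive_coord//; apply: derivableP; exact: (derivable_mxP A x v).1 DA j i.
Qed.

Lemma is_derive_comp_mx n p q (U : set 'rV[R]_n) (c : V -> 'rV[R]_n)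
    (f : 'rV[R]_n -> 'M[R]_(p, q)) t v : open U -> Ck 1 U f -> U (c t) ->
  derivable c t v ->
  is_derive t v (fun s => f (c s)) (\sum_a 'D_v c t 0 a *: partial a f (c t)).
Proof.
move=> oU f1 Uc Dc.
have -> : \sum_a 'D_v c t 0 a *: partial a f (c t) =
    \matrix_(i, j) \sum_a 'D_v c t 0 a * partial a (fun x => f x i j) (c t).
  apply/matrixP => i j; rewrite summxE mxE; apply: eq_bigr => a _; rewrite mxE.
  have Df : derivable f (c t) 'e_a := CkS_derivable _ f1 Uc.
  by congr (_ * _); exact: derive_coord.
apply: is_derive_mx => i j; apply: (@is_derive_comp_rV _ _ _ c (fun x => f x i j)) => //.
have fij : Ck 1 U (fun x => f x i j : R) by apply: Ck_coord.
exact: C1_differentiable oU fij Uc.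
Qed.

End MatrixDerivative.

(** * The Levi-Civita symbols at one point, as linear algebra *)

Section Christoffel.
Context {R : realFieldType} {n : nat}.
Variables (g : 'M[R]_n) (dg : 'I_n -> 'M[R]_n).
Hypothesis gu : g \in unitmx.
Hypothesis gsym : g^T = g.
Hypothesis dgsym : forall m, (dg m)^T = dg m.

(* Rows and columns are the second lower index and the upper index. *)
Definition christoffel (m : 'I_n) : 'M[R]_n :=
  \matrix_(a, c) (2^-1 * \sum_k invmx g c k * (dg m k a + dg a k m - dg k m a)).

Let christoffel_lower m a b :
  (christoffel m *m g) a b = 2^-1 * (dg m b a + dg a b m - dg b m a).
Proof.
pose u : 'cV[R]_n := \col_k (dg m k a + dg a k m - dg k m a).
have -> : (christoffel m *m g) a b = 2^-1 * (g *m (invmx g *m u)) b 0.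
  rewrite !mxE mulr_sumr; apply: eq_bigr => c _; rewrite !mxE.
  have -> : g b c = g c b by rewrite -[in LHS]gsym mxE.
  rewrite -[LHS]mulrA; congr (_ * _); rewrite [LHS]mulrC.
  by congr (_ * _); apply: eq_bigr => k _; rewrite mxE.
by rewrite mulmxA mulmxV// mul1mx mxE.
Qed.

Let dgE m a b : dg m a b = dg m b a.
Proof. by rewrite -[in LHS]dgsym mxE. Qed.

Lemma christoffel_metric m : dg m = christoffel m *m g + g *m (christoffel m)^T.
Proof.
have -> : g *m (christoffel m)^T = (christoffel m *m g)^T by rewrite trmx_mul gsym.
apply/matrixP => a b; rewrite [RHS]mxE [X in _ = _ + X]mxE !christoffel_lower.
rewrite (dgE m b a) (dgE a b m) (dgE b a m); lra.
Qed.

(** Koszul's argument: metricity writes [dg] through the lowered symbols, and their symmetry lets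
    the alternating sum over cyclic permutations isolate a single one. *)
Lemma christoffel_unique (K : 'I_n -> 'M[R]_n) :
  (forall m a c, K m a c = K a m c) ->
  (forall m, dg m = K m *m g + g *m (K m)^T) ->
  forall m, K m = christoffel m.
Proof.
move=> Ksym Kg m; pose k m := K m *m g.
have ksym i a b : k i a b = k a i b.
  by rewrite /k !mxE; apply: eq_bigr => c _; rewrite Ksym.
have dgk i a b : dg i a b = k i a b + k i b a.
  by rewrite Kg -[g in X in _ + X]gsym -trmx_mul !mxE.
suff : K m *m g = christoffel m *m g by move/(can_inj (mulmxK gu)).
apply/matrixP => a b; rewrite christoffel_lower !dgk -/(k m).
rewrite (ksym m b a) (ksym a b m) (ksym a m b); lra.
Qed.

Lemma christoffel_sym m a c : christoffel m a c = christoffel a m c.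
Proof.
rewrite !mxE; congr (_ * _); apply: eq_bigr => k _.
by rewrite [dg m k a + _]addrC (dgE k m a).
Qed.

End Christoffel.

(* The pull-back of the symbols of gj is again symmetric and metric, so it must be
   the Christoffel symbol of gi. *)
Lemma christoffel_pullback (R : realFieldType) n (J gi gj : 'M[R]_n)
    (dgi dgj H : 'I_n -> 'M[R]_n) :
  gi \in unitmx -> gj \in unitmx -> gj^T = gj -> gi = J *m gj *m J^T ->
  (forall m, (dgj m)^T = dgj m) -> (forall m a c, H m a c = H a m c) ->
  (forall m, dgi m = H m *m gj *m J^T
     + J *m (\sum_f J m f *: dgj f) *m J^T + J *m gj *m (H m)^T) ->
  forall m, christoffel gi dgi m *m J =
    H m + \sum_d J m d *: (J *m christoffel gj dgj d).
Proof.
move=> giu gju gjs gJ dgjs Hs dgiE.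
have Ju : J \in unitmx.
  by move: giu; rewrite gJ !unitmx_mul => /andP[/andP[]].
have gis : gi^T = gi by rewrite gJ !trmx_mul trmxK gjs mulmxA.
(* [N m *m invmx J] is the pull-back of the symbols of [gj]: symmetric because [H] and those symbols
   are, and metric for [gi] by [mid] and the formula for [dgi]. *)
pose N m := H m + \sum_d J m d *: (J *m christoffel gj dgj d).
have Nsym m k c : N m k c = N k m c.
  rewrite /N mxE [RHS]mxE Hs; congr (_ + _); rewrite !summxE.
  transitivity (\sum_d \sum_e J m d * J k e * christoffel gj dgj d e c).
    apply: eq_bigr => d _; rewrite mxE [X in _ * X]mxE mulr_sumr.
    by apply: eq_bigr => e _; rewrite mulrA.
  rewrite exchange_big/=; apply: eq_bigr => e _; rewrite [RHS]mxE [X in _ * X]mxE mulr_sumr.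
  apply: eq_bigr => d _; rewrite (christoffel_sym _ dgjs) mulrA; congr (_ * _); exact: mulrC.
have mid m : J *m (\sum_d J m d *: dgj d) *m J^T =
    (\sum_d J m d *: (J *m christoffel gj dgj d)) *m gj *m J^T +
    J *m gj *m (\sum_d J m d *: (J *m christoffel gj dgj d))^T.
  rewrite [(\sum_d _)^T]linear_sum !mulmx_sumr !mulmx_suml -big_split/=; apply: eq_bigr => d _.
  rewrite [(_ *: _)^T]linearZ/= -!(scalemxAl, scalemxAr) -scalerDr; congr (_ *: _).
  by rewrite {1}(christoffel_metric gju gjs dgjs d) mulmxDr mulmxDl trmx_mul !mulmxA.
have Kg m : dgi m = (N m *m invmx J) *m gi + gi *m (N m *m invmx J)^T.
  have E : N m *m invmx J *m gi = N m *m gj *m J^T.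
    by rewrite {1}gJ !mulmxA mulmxKV.
  have -> : gi *m (N m *m invmx J)^T = (N m *m invmx J *m gi)^T.
    by rewrite [RHS]trmx_mul gis.
  rewrite E [(_ *m J^T)^T]trmx_mul trmxK [(N m *m _)^T]trmx_mul gjs mulmxA.
  rewrite dgiE mid /N linearD/= mulmxDr !mulmxDl.
  by rewrite -!addrA; do 2 congr (_ + _); rewrite addrC.
move=> m; rewrite -(christoffel_unique giu gis (K := fun m => N m *m invmx J)) ?mulmxKV//.
by move=> k a c; rewrite mxE [RHS]mxE; apply: eq_bigr => e _; rewrite Nsym.
Qed.

Lemma matrix_pullback_entry (R : comNzRingType) n (J A H : 'M[R]_n) (B : 'I_n -> 'M[R]_n) (a :
  'I_n) :
  A *m J = H + \sum_d J a d *: (J *m B d) ->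
  forall b l, \sum_c A b c * J c l =
    H b l + \sum_d \sum_e B d e l * J a d * J b e.
Proof.
move=> E b l; have := congr1 (fun A : 'M[R]_n => A b l) E; rewrite !mxE summxE => ->.
congr (_ + _); apply: eq_bigr => d _; rewrite !mxE mulr_sumr; apply: eq_bigr => e _; ring.
Qed.

(** * Arithmetic of differentiability classes *)

Section Regularity.

Definition reg_le (k : nat) (r : regularity) : Prop :=
  if r is Some m then (k <= m)%N else True.

(** Treats finite and infinite classes alike, as statements about all finite orders, on which
    induction is available. *)
Lemma CrP (R : realType) (V W : normedModType R) r (U : set V) (f : V -> W) :
  Cr r U f <-> forall k, reg_le k r -> Ck k U f.
Proof.
case: r => [m|] /=; split=> H.
- by move=> k km; exact: Ck_le H.
- exact: H.
- by move=> k _; exact: H.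
- by move=> k; exact: H.
Qed.

Lemma reg_le_sub k r s : at_least_C2 r -> (s <= 2)%N ->
  reg_le k (reg_sub r s) -> reg_le (k + s) r.
Proof.
case: r => [m|] //= m2 s2; by rewrite leq_subRL ?(leq_trans s2)// addnC.
Qed.

(** Metrics have one derivative more than connections, so the first derivatives of a metric are as
    regular as connection symbols. The truncated subtractions are genuine because [r] is at least
    2. *)
Lemma reg_sub1 k r : at_least_C2 r -> reg_le k (reg_sub r 2) -> reg_le k.+1 (reg_sub r 1).
Proof.
move=> r2 /(reg_le_sub r2 (leqnn 2)); case: r r2 => [m|] //= r2.
by rewrite leq_subRL ?(ltnW r2)// add1n addn2.
Qed.

End Regularity.

(** * Overlaps of charts *)

Section Overlap.
Context {R : realType} {n : nat} {M : topologicalType}.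
Implicit Types c d : chart R n M.

Lemma coord_point c x : (coord c @` dom c) x -> coord c (point c x) = x.
Proof. by move=> [p cp <-]; rewrite coordK. Qed.

Lemma dom_point c x : (coord c @` dom c) x -> dom c (point c x).
Proof. by move=> [p cp <-]; rewrite coordK. Qed.

Lemma overlapP c d x :
  overlap c d x <-> (coord c @` dom c) x /\ dom d (point c x).
Proof.
split=> [[p [cp dp] <-]|[[p cp <-]]].
  by split; [exists p|rewrite coordK].
by rewrite coordK// => dp; exists p.
Qed.

Lemma overlap_img c d x : overlap c d x -> (coord c @` dom c) x.
Proof. by move=> /overlapP[]. Qed.

Lemma transition_img c d x : overlap c d x -> (coord d @` dom d) (transition c d x).
Proof. by move=> /overlapP[_ dx]; exists (point c x). Qed.

Lemma open_overlap c d : open (overlap c d).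
Proof.
rewrite openE => x /overlapP[cx dx]; rewrite /interior.
have : \forall y \near x, dom d (point c y).
  by apply: (@point_continuous _ _ _ c x cx); apply: open_nbhs_nbhs; split => //; exact: dom_open.
have : \forall y \near x, (coord c @` dom c) y.
  by apply: open_nbhs_nbhs; split => //; exact: img_open.
by apply: filterS2 => y cy dy; apply/overlapP.
Qed.

End Overlap.

(** * Transition maps, metrics and Levi-Civita symbols in two charts *)

Section ManifoldGeometry.
Context {R : realType} {n : nat} {r : regularity} {M : manifold R n r}.
Hypothesis r2 : at_least_C2 r.
Implicit Types (i j : atlas M) (g : metric M).

Local Notation tau i j := (transition (ch i) (ch j)).

Lemma img_open_atlas i : open (img i).
Proof. exact: img_open. Qed.
Arguments img_open_atlas : clear implicits.

Lemma reg_le2 : reg_le 2 r.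
Proof. by case: (r) r2. Qed.

Lemma transition_C2 i j : Ck 2 (overlap (ch i) (ch j)) (tau i j).
Proof. by apply: (CrP _ _ _).1 (ch_compatible i j) 2 reg_le2. Qed.

Lemma metric_C1 g i : Ck 1 (img i) (g i).
Proof. by apply: (CrP _ _ _).1 (gc_regular g i) 1 _; case: (r) r2 => //= m m2;
  rewrite subn_gt0. Qed.

Lemma partial_coord p q (f : 'rV[R]_n -> 'M[R]_(p, q)) (U : set 'rV[R]_n) x a b c :
  Ck 1 U f -> U x ->
  partial a f x b c = partial a (fun y => f y b c : R) x.
Proof.
move=> f1 Ux; have Df : derivable f x 'e_a := CkS_derivable _ f1 Ux.
exact: derive_coord.
Qed.

Definition hessian i j x (m : 'I_n) : 'M[R]_n :=
  \matrix_(a, c) partial m (partial a (tau i j)) x 0 c.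

Lemma is_derive_transition i j x v : overlap (ch i) (ch j) x ->
  is_derive x v (tau i j) (v *m jac i j x).
Proof.
move=> xo; have oo := @open_overlap R n M (ch i) (ch j).
have t1 := Ck_le (isT : (1 <= 2)%N) (transition_C2 i j).
have Dt := CkS_derivable v t1 xo.
suff -> : v *m jac i j x = 'D_v (tau i j) x by exact: derivableP.
apply/rowP => c; rewrite mxE derive_coord//.
have dc : differentiable (fun y => tau i j y 0 c : R) x.
  have tc : Ck 1 (overlap (ch i) (ch j)) (fun y => tau i j y 0 c : R) by apply: Ck_coord.
  exact: C1_differentiable oo tc xo.
rewrite deriveE// {2}(row_sum_delta v) linear_sum; apply: eq_bigr => a _.
by rewrite linearZ/= -deriveE// mxE (partial_coord _ _ _ t1 xo).
Qed.

Lemma is_derive_jac i j x m : overlap (ch i) (ch j) x ->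
  is_derive x 'e_m (jac i j) (hessian i j x m).
Proof.
move=> xo; have oo := @open_overlap R n M (ch i) (ch j).
apply: is_derive_mx => a c; have ta := CkS_derive 'e_a (transition_C2 i j).
have Dta : derivable (partial a (tau i j)) x 'e_m := CkS_derivable _ ta xo.
rewrite (_ : (fun y => _) = (fun y => partial a (tau i j) y 0 c)); last first.
  by apply/funext => y; rewrite mxE.
rewrite [partial m _ _](_ : _ = 'D_('e_m) (partial a (tau i j)) x)// derive_coord//.
by apply: derivableP; exact: (derivable_mxP _ _ _).1 Dta 0 c.
Qed.

(** Read off from the transformation law of a metric: the Jacobian is a factor of an invertible
    matrix. *)
Lemma jac_unit g i j x : overlap (ch i) (ch j) x -> jac i j x \in unitmx.
Proof.
move=> xo; have := gc_nondegenerate g (overlap_img xo); rewrite (gc_law g xo).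
by rewrite unitmx_mul unitmx_mul => /andP[/andP[]].
Qed.

Lemma hessianE i j x m a c :
  hessian i j x m a c = partial m (partial a (tau i j)) x 0 c.
Proof. by rewrite [LHS]mxE. Qed.

(** In the transformation law of a symmetric connection all terms other than the second derivative
    are symmetric in the lower indices. This takes the place of Schwarz's theorem. *)
Lemma hessian_sym (G : connection M) i j x m a c : overlap (ch i) (ch j) x ->
  hessian i j x m a c = hessian i j x a m c.
Proof.
move=> xo; apply: etrans (hessianE i j x m a c) _; apply: etrans _ (esym (hessianE i j x a m c)).
have H1 := cc_law G c m a xo; have H2 := cc_law G c a m xo.
have := H1; under eq_bigr do rewrite (cc_sym G _ _ _ (overlap_img xo)).
rewrite H2 exchange_big/= => /esym.
have -> : \sum_d \sum_e cc G j (tau i j x) c e d * jac i j x a e * jac i j x m d =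
   \sum_d \sum_e cc G j (tau i j x) c d e * jac i j x m d * jac i j x a e.
  apply: eq_bigr => d _; apply: eq_bigr => e _.
  by rewrite (cc_sym G _ _ _ (transition_img xo)) mulrAC.
exact: addIr.
Qed.

Lemma partial_metric_law g i j x m : overlap (ch i) (ch j) x ->
  let J := jac i j x in let gj := g j (tau i j x) in
  partial m (g i) x =
  hessian i j x m *m gj *m J^T
  + J *m (\sum_f J m f *: partial f (g j) (tau i j x)) *m J^T
  + J *m gj *m (hessian i j x m)^T.
Proof.
move=> xo J gj; have oo := @open_overlap R n M (ch i) (ch j).
have Dtau := is_derive_transition 'e_m xo.
have Dgj : is_derive x 'e_m (fun y => g j (tau i j y))
    (\sum_f J m f *: partial f (g j) (tau i j x)).
  have := is_derive_comp_mx (img_open_atlas j) (metric_C1 g j) (transition_img xo)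
    (@ex_derive _ _ _ _ _ _ _ Dtau).
  by rewrite (@derive_val _ _ _ _ _ _ _ Dtau) -rowE; under eq_bigr do rewrite mxE.
have DJ := is_derive_jac m xo.
have := is_derive_mulmx (is_derive_mulmx DJ Dgj) (is_derive_trmx DJ).
rewrite mulmxDl => /(@derive_val _ _ _ _ _ _ _) <-.
rewrite /partial; apply: near_eq_derive.
have : \forall y \near x, overlap (ch i) (ch j) y by apply: open_nbhs_nbhs.
by apply: filterS => y yo; exact: gc_law.
Qed.

Lemma partial_metric_sym g i x m : img i x -> (partial m (g i) x)^T = partial m (g i) x.
Proof.
move=> xi; have g1 := metric_C1 g i.
have Dg : is_derive x 'e_m (g i) (partial m (g i) x).
  by apply: derivableP; exact: CkS_derivable g1 xi.
rewrite -[LHS](@derive_val _ _ _ _ _ _ _ (is_derive_trmx Dg)); apply: near_eq_derive.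
have : \forall y \near x, img i y by apply: open_nbhs_nbhs; split => //; exact: img_open_atlas.
by apply: filterS => y yi; exact: gc_sym.
Qed.

(** A predicate on bare symbols, because [levi_civita] is not packaged as a [connection]. *)
Definition transforms_as_connection (S : symbols M) : Prop :=
  forall i j x l a b, overlap (ch i) (ch j) x ->
    \sum_c S i x c a b * jac i j x c l =
    partial a (partial b (tau i j)) x 0 l +
    \sum_d \sum_e S j (tau i j x) l d e * jac i j x a d * jac i j x b e.

Lemma levi_civitaE g i x l a b :
  levi_civita g i x l a b = christoffel (g i x) (fun m => partial m (g i) x) a b l.
Proof. by rewrite mxE. Qed.

Lemma levi_civita_sym g i x l a b : img i x ->
  levi_civita g i x l a b = levi_civita g i x l b a.
Proof.
by move=> xi; rewrite !levi_civitaE christoffel_sym// => m; exact: partial_metric_sym.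
Qed.

Lemma levi_civita_metric g i x m : img i x ->
  let L := \matrix_(a, c) levi_civita g i x c m a in
  partial m (g i) x = L *m g i x + g i x *m L^T.
Proof.
move=> xi L; have -> : L = christoffel (g i x) (fun m => partial m (g i) x) m.
  by apply/matrixP => a c; rewrite mxE levi_civitaE.
apply: (christoffel_metric (gc_nondegenerate g xi) (gc_sym g xi)) => k.
exact: partial_metric_sym.
Qed.

(* The connection G only serves to know that the second derivatives of the
   transition map commute. *)
Lemma levi_civita_law (G : connection M) g : transforms_as_connection (levi_civita g).
Proof.
move=> i j x l a b xo; have xi := overlap_img xo; have yj := transition_img xo.
have E := christoffel_pullback (gc_nondegenerate g xi) (gc_nondegenerate g yj)
  (gc_sym g yj) (gc_law g xo) (fun m => partial_metric_sym g m yj)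
  (fun m a c => hessian_sym G m a c xo) (fun m => partial_metric_law g m xo) a.
apply: etrans (etrans (matrix_pullback_entry E b l) _).
  by apply: eq_bigr => c _; exact: (congr1 (fun z => z * _) (levi_civitaE g i x c a b)).
apply: (congr2 +%R (hessianE i j x a b l)); apply: eq_bigr => d _; apply: eq_bigr => e _.
exact: (congr1 (fun z => z * _ * _) (esym (levi_civitaE g j _ l d e))).
Qed.

End ManifoldGeometry.

(** * Existence of light-like geodesics *)

Section AccelerationForm.
Context {R : comNzRingType} {n : nat}.

Definition acceleration_form (S : 'I_n -> 'I_n -> 'I_n -> R) (w w' : 'rV[R]_n) : 'rV[R]_n :=
  \row_l (w' 0 l + \sum_a \sum_b S l a b * w 0 a * w 0 b).

(** The vector character of the acceleration: the quadratic term in [H] produced by differentiating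
    the transition map twice is exactly the inhomogeneous term in the law of the symbols. *)
Lemma acceleration_form_law (Si Sj : 'I_n -> 'I_n -> 'I_n -> R) (J : 'M[R]_n)
    (H : 'I_n -> 'M[R]_n) (w w' : 'rV[R]_n) :
  (forall l a b, \sum_c Si c a b * J c l =
     H a b l + \sum_d \sum_e Sj l d e * J a d * J b e) ->
  acceleration_form Sj (w *m J) (w' *m J + w *m \sum_a w 0 a *: H a) =
  acceleration_form Si w w' *m J.
Proof.
move=> law; apply/rowP => l; rewrite [LHS]mxE [RHS]mxE.
have -> : \sum_k acceleration_form Si w w' 0 k * J k l =
  (w' *m J) 0 l + \sum_a \sum_b w 0 a * w 0 b * \sum_k Si k a b * J k l.
  rewrite [X in _ = X + _]mxE.
  under eq_bigr do rewrite mxE mulrDl.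
  rewrite big_split/=; congr (_ + _).
  under eq_bigr => k _ do [rewrite mulr_suml; under eq_bigr => a _ do rewrite mulr_suml].
  rewrite exchange_big/=; apply: eq_bigr => a _; rewrite exchange_big/=.
  apply: eq_bigr => b _; rewrite mulr_sumr; apply: eq_bigr => k _; ring.
under [in RHS]eq_bigr => a _ do [under eq_bigr => b _ do rewrite law mulrDr;
  rewrite big_split/=].
rewrite big_split/= addrA mxE; congr (_ + _ + _).
- rewrite mxE exchange_big/=; apply: eq_bigr => b _.
  by rewrite summxE mulr_sumr; apply: eq_bigr => a _; rewrite !mxE; ring.
- under [RHS]eq_bigr => a _ do under eq_bigr => b _ do rewrite mulr_sumr.
  under [RHS]eq_bigr => a _ do rewrite exchange_big/=.
  rewrite [RHS]exchange_big/=; apply: eq_bigr => d _.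
  under [RHS]eq_bigr => a _ do under eq_bigr => b _ do rewrite mulr_sumr.
  under [RHS]eq_bigr => a _ do rewrite exchange_big/=.
  rewrite [RHS]exchange_big/=; apply: eq_bigr => e _.
  rewrite !mxE -mulrA mulr_suml mulr_sumr; apply: eq_bigr => a _.
  rewrite !mulr_sumr; apply: eq_bigr => b _; ring.
Qed.

End AccelerationForm.

(** * Velocity and acceleration of a curve in two charts *)

Section CurveTransformation.
Context {R : realType} {n : nat} {r : regularity} {M : manifold R n r}.
Hypothesis r2 : at_least_C2 r.
Implicit Types (i j : atlas M) (g : metric M) (c : R -> 'rV[R]_n).

Local Notation tau i j := (transition (ch i) (ch j)).

Definition coord_acceleration (S : symbols M) i c (t : R) : 'rV[R]_n :=
  acceleration_form (S i (c t)) (derive1 c t) (derive1 (derive1 c) t).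

Lemma Ck_derive1 k (O : set R) c : Ck k.+1 O c -> Ck k O (derive1 c).
Proof.
move=> kc; rewrite (_ : derive1 c = (fun t => 'D_1 c t)); first exact: CkS_derive.
by apply/funext => t; rewrite derive1E.
Qed.

Lemma C1_is_derive1 (O : set R) c t : Ck 1 O c -> O t -> is_derive t 1 c (derive1 c t).
Proof. by move=> c1 Ot; rewrite derive1E; apply: derivableP; exact: CkS_derivable c1 Ot. Qed.

Lemma row_mul_jac i j x (w : 'rV[R]_n) :
  \sum_a w 0 a *: partial a (tau i j) x = w *m jac i j x.
Proof.
apply/rowP => l; rewrite [RHS]mxE summxE; apply: eq_bigr => a _.
apply: etrans (mxE _ _ _ _) _; congr (_ * _); apply/esym; exact: mxE.
Qed.

Lemma is_derive_transition_curve i j c t : derivable c t 1 ->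
  overlap (ch i) (ch j) (c t) ->
  is_derive t 1 (tau i j \o c) (derive1 c t *m jac i j (c t)).
Proof.
move=> Dc ct; have t1 := Ck_le (isT : (1 <= 2)%N) (transition_C2 r2 i j).
have := is_derive_comp_mx (@open_overlap R n M (ch i) (ch j)) t1 ct Dc.
suff -> : \sum_a 'D_1 c t 0 a *: partial a (tau i j) (c t) = derive1 c t *m jac i j (c t) by [].
by rewrite derive1E; exact: row_mul_jac.
Qed.

Lemma Ck1_jac i j : Ck 1 (overlap (ch i) (ch j)) (jac i j).
Proof.
have oo := @open_overlap R n M (ch i) (ch j); apply: Ck_mx => // a b.
have ta : Ck 1 (overlap (ch i) (ch j)) (partial a (tau i j)).
  exact: CkS_derive (transition_C2 r2 i j).
have tab := Ck_coord 0 b oo ta.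
by apply: Ck_eq tab => // x _; apply/esym; exact: mxE.
Qed.

Lemma is_derive2_transition_curve i j c t (O : set R) : open O -> Ck 2 O c -> O t ->
  (forall s, O s -> overlap (ch i) (ch j) (c s)) ->
  is_derive t 1 (derive1 (tau i j \o c))
    (derive1 (derive1 c) t *m jac i j (c t) +
     derive1 c t *m \sum_a derive1 c t 0 a *: hessian i j (c t) a).
Proof.
move=> oO c2 Ot Oc; have oo := @open_overlap R n M (ch i) (ch j).
have c1 := Ck_le (isT : (1 <= 2)%N) c2.
have Dc s : O s -> derivable c s 1 by move=> Os; exact: CkS_derivable c1 Os.
have DJ : is_derive t 1 (fun s => jac i j (c s)) (\sum_a derive1 c t 0 a *: hessian i j (c t) a).
  have := is_derive_comp_mx oo (Ck1_jac i j) (Oc t Ot) (Dc t Ot).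
  rewrite derive1E; under eq_bigr => a _ do
    rewrite [partial _ _ _](@derive_val _ _ _ _ _ _ _ (is_derive_jac r2 a (Oc t Ot))).
  by [].
have := is_derive_mulmx (C1_is_derive1 (Ck_derive1 c2) Ot) DJ.
apply: near_eq_is_derive.
have : \forall s \near t, O s by apply: open_nbhs_nbhs.
apply: filterS => s Os; apply/esym; apply: etrans (derive1E _ _) _.
exact: (@derive_val _ _ _ _ _ _ _ (is_derive_transition_curve (Dc s Os) (Oc s Os))).
Qed.

Lemma coord_acceleration_law (S : symbols M) i j c t (O : set R) :
  transforms_as_connection S -> open O -> Ck 2 O c -> O t ->
  (forall s, O s -> overlap (ch i) (ch j) (c s)) ->
  coord_acceleration S j (tau i j \o c) t = coord_acceleration S i c t *m jac i j (c t).
Proof.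
move=> Slaw oO c2 Ot Oc; have c1 := Ck_le (isT : (1 <= 2)%N) c2.
have Dc : derivable c t 1 by exact: CkS_derivable c1 Ot.
have E1 := etrans (derive1E _ _)
  (@derive_val _ _ _ _ _ _ _ (is_derive_transition_curve Dc (Oc t Ot))).
have E2 := etrans (derive1E _ _)
  (@derive_val _ _ _ _ _ _ _ (is_derive2_transition_curve oO c2 Ot Oc)).
rewrite /coord_acceleration.
apply: etrans (congr2 (acceleration_form _) E1 E2) _.
apply: acceleration_form_law => l a b.
apply: etrans (Slaw i j (c t) l a b (Oc t Ot)) _.
exact: (congr1 (fun z => z + _) (esym (hessianE i j (c t) a b l))).
Qed.

Lemma levi_civita_Ck g i k l a b : reg_le k (reg_sub r 2) ->
  Ck k (img i) (fun x => levi_civita g i x l a b).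
Proof.
move=> kr; have oi : open (img i) by exact: img_open.
have gk : Ck k.+1 (img i) (g i) := (CrP _ _ _).1 (gc_regular g i) _ (reg_sub1 r2 kr).
have dgk m u v : Ck k (img i) (fun x => partial m (g i) x u v).
  by apply: Ck_coord => //; exact: CkS_derive.
apply: CkM => //; first exact: Ck_cst.
apply: Ck_sum => // m _; apply: CkM => //.
  apply: Ck_invmx => //; first by move=> x xi; exact: gc_nondegenerate.
  by move=> u v; apply: Ck_coord => //; exact: Ck_le gk.
by apply: CkB => //; apply: CkD.
Qed.

End CurveTransformation.

(** * Curves and compact balls in the space of positions and velocities *)

Section ProductCurves.
Context {R : realType}.

Lemma is_derive_fst (V W : normedModType R) (z : R -> V * W) (t : R) dz :
  is_derive t 1 z dz -> is_derive t 1 (fst \o z) dz.1.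
Proof.
move=> Dz; have H : h^-1 *: ((z \o shift t) (h *: 1) - z t) @[h --> (0 : R)^'] --> dz.
  by rewrite -(@derive_val _ _ _ _ _ _ _ Dz); exact: (@ex_derive _ _ _ _ _ _ _ Dz).
have H1 : h^-1 *: (((fst \o z) \o shift t) (h *: 1) - (fst \o z) t) @[h --> (0 : R)^'] --> dz.1.
  exact: (cvg_comp _ _ H (@cvg_fst _ _ (nbhs dz.1) (nbhs dz.2) _)).
by apply: DeriveDef; [apply/cvg_ex; exists dz.1|exact: cvg_lim H1].
Qed.

Lemma is_derive_snd (V W : normedModType R) (z : R -> V * W) (t : R) dz :
  is_derive t 1 z dz -> is_derive t 1 (snd \o z) dz.2.
Proof.
move=> Dz; have H : h^-1 *: ((z \o shift t) (h *: 1) - z t) @[h --> (0 : R)^'] --> dz.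
  by rewrite -(@derive_val _ _ _ _ _ _ _ Dz); exact: (@ex_derive _ _ _ _ _ _ _ Dz).
have H1 : h^-1 *: (((snd \o z) \o shift t) (h *: 1) - (snd \o z) t) @[h --> (0 : R)^'] --> dz.2.
  exact: (cvg_comp _ _ H (@cvg_snd _ _ (nbhs dz.1) (nbhs dz.2) _)).
by apply: DeriveDef; [apply/cvg_ex; exists dz.2|exact: cvg_lim H1].
Qed.

Lemma rV_balls_compact n (x : 'rV[R]_n) (r : R) :
  exists2 K, compact K & forall z, `|z - x| <= r -> K z.
Proof.
exists (closed_ball_ Num.norm x r); last by move=> z zr; rewrite /closed_ball_/= distrC.
apply: bounded_closed_compact; last exact: closed_closed_ball_.
exists (`|x| + r); split; first exact: num_real.
move=> B Br z; rewrite /closed_ball_/= => xz.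
have -> : z = x - (x - z) by rewrite opprB addrC subrK.
by apply: le_trans (ler_normB _ _) _; apply: le_trans (ltW Br); rewrite lerD2l.
Qed.

Lemma pair_balls_compact m n (z0 : 'rV[R]_m * 'rV[R]_n) (r : R) :
  exists2 K, compact K & forall z, `|z - z0| <= r -> K z.
Proof.
have [K1 K1c H1] := rV_balls_compact z0.1 r; have [K2 K2c H2] := rV_balls_compact z0.2 r.
exists (K1 `*` K2); first exact: compact_setX.
move=> z; rewrite prod_normE/= ge_max => /andP[zr1 zr2].
by split; [exact: H1|exact: H2].
Qed.

End ProductCurves.

(** * The geodesic equation as a first-order system *)

Section LightLikeGeodesics.
Context {R : realType} {n : nat} {r : regularity} {M : manifold R n r}.
Hypothesis r2 : at_least_C2 r.
Implicit Types (i j : atlas M) (g : metric M).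

Local Notation tau i j := (transition (ch i) (ch j)).

(** The field on pairs of position and velocity. With the symbols negated and second derivative 0,
    [acceleration_form] is the quadratic right-hand side of the geodesic equation solved for the
    second derivative. *)
Lemma spray_continuous g i (z : 'rV[R]_n * 'rV[R]_n) : img i z.1 ->
  {for z, continuous (fun y => (y.2, acceleration_form
     (fun l a b => - levi_civita g i y.1 l a b) y.2 0))}.
Proof.
move=> zi; have fst_c y : {for y, continuous (fst : 'rV[R]_n * 'rV[R]_n -> _)} by exact: cvg_fst.
have snd_c y : {for y, continuous (snd : 'rV[R]_n * 'rV[R]_n -> _)} by exact: cvg_snd.
have c2 := snd_c z.
suff ca : {for z, continuous (fun y : 'rV[R]_n * 'rV[R]_n => acceleration_form
     (fun l a b => - levi_civita g i y.1 l a b) y.2 0)} by exact: (cvg_pair c2 ca).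
pose U : set ('rV[R]_n * 'rV[R]_n) := fst @^-1` (img i).
have oi : open (img i) by exact: img_open.
have oU : open U by apply: open_comp => // y _; exact: cvg_fst.
have coord2 a : Ck 0 U (fun y => y.2 0 a : R).
  have s2 : Ck 0 U (snd : 'rV[R]_n * 'rV[R]_n -> 'rV[R]_n).
    by split=> [y _|//]; exact: snd_c.
  exact: (Ck_coord 0 a oU s2).
apply: (@Ck_continuous _ _ _ 0 U (fun y => acceleration_form
     (fun l a b => - levi_civita g i y.1 l a b) y.2 0)) => //.
apply: Ck_mx => // k l.
suff H : Ck 0 U (fun y => \sum_a \sum_b - levi_civita g i y.1 l a b * y.2 0 a * y.2 0 b).
  by apply: Ck_eq H => // y _; rewrite ord1 [RHS]mxE mxE add0r.
apply: Ck_sum => // a _; apply: Ck_sum => // b _; apply: CkM => //; apply: CkM => //.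
apply: CkN => //; split=> // y yU.
apply: (@continuous_comp _ _ _ fst (fun x => levi_civita g i x l a b)); first exact: fst_c.
have LC0 : Ck 0 (img i) (fun x => levi_civita g i x l a b).
  by apply: levi_civita_Ck => //; case: (r).
exact: Ck_continuous LC0 yU.
Qed.

Lemma levi_civita_solution g i x0 v : img i x0 -> v != 0 ->
  exists (T : R) (c w : R -> 'rV[R]_n), [/\ 0 < T, c 0 = x0, w 0 = v &
    forall t : R, `|t| < T -> [/\ img i (c t), w t != 0, is_derive t 1 c (w t) &
      is_derive t 1 w (- acceleration_form (levi_civita g i (c t)) (w t) 0)]].
Proof.
move=> x0i v0; have oi : open (img i) by exact: img_open.
(* A nonzero velocity is an open condition, put into the domain so that the solution is a regular
   curve. *)
pose U : set ('rV[R]_n * 'rV[R]_n) := fst @^-1` (img i) `&` snd @^-1` [set w | w != 0].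
have oU : open U.
  apply: openI; first by apply: open_comp => // y _; exact: cvg_fst.
  apply: open_comp => [y _|]; first exact: cvg_snd.
  have -> : [set w : 'rV[R]_n | w != 0] = ~` [set 0].
    by apply/seteqP; split=> w /= /eqP.
  apply: closed_openC; apply: accessible_closed_set1.
  by apply: hausdorff_accessible; exact: norm_hausdorff.
have [|T [z [T0 z0 Hz]]] := @peano_local R _ (@pair_balls_compact R n n) U _ (x0, v) oU _
    (fun y yU => @spray_continuous g i y yU.1); first by split.
exists T, (fst \o z), (snd \o z); split => //; rewrite /= ?z0// => t tT.
have [[zi zn] Dz] := Hz t tT; split => //.
  by have := is_derive_fst Dz.
have := is_derive_snd Dz; rewrite [X in is_derive _ _ _ X -> _]/=.
suff -> : acceleration_form (fun l a b => - levi_civita g i (z t).1 l a b) (z t).2 0 =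
  - acceleration_form (levi_civita g i (z t).1) (z t).2 0 by [].
apply/rowP => l; rewrite mxE [RHS]mxE [X in - X]mxE mxE !add0r -sumrN.
by apply: eq_bigr => a _; rewrite -sumrN; apply: eq_bigr => b _; rewrite !mulNr.
Qed.

End LightLikeGeodesics.

(** * Regularity of curves *)

Section CurveRegularity.
Context {R : realType}.

Lemma open_preimage_in (V : normedModType R) (O : set R) (U : set V) (c : R -> V) :
  open O -> open U -> (forall t, O t -> {for t, continuous c}) ->
  open (O `&` c @^-1` U).
Proof.
move=> oO oU cc; rewrite openE => t [Ot Uct]; rewrite /interior.
have H1 : \forall s \near t, O s by exact: open_nbhs_nbhs.
have H2 : \forall s \near t, U (c s) by apply: (cc t Ot); exact: open_nbhs_nbhs.
exact: filterS2 H1 H2.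
Qed.

(** On the real line [Ck] still quantifies over all directions, that is over all multiples of the
    unit one. *)
Lemma is_derive_scale_direction (V : normedModType R) (f : R -> V) (t s : R) d :
  is_derive t 1 f d -> is_derive t s f (s *: d).
Proof.
move=> Df; have dft : differentiable f t.
  by apply/derivable1_diffP; exact: (@ex_derive _ _ _ _ _ _ _ Df).
have E : derive1 f t = d by rewrite derive1E; exact: (@derive_val _ _ _ _ _ _ _ Df).
apply: DeriveDef; first exact: diff_derivable.
by rewrite deriveE// diff1E// E.
Qed.

Lemma Ck_curve n k (O : set R) (c w : R -> 'rV[R]_n) : open O ->
  (forall t, O t -> is_derive t 1 c (w t)) -> Ck k O w -> Ck k.+1 O c.
Proof.
move=> oO Dc kw; apply: (@CkS_intro R R _ k O c (fun s t : R => s *: w t)) => //.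
- move=> t Ot; apply/differentiable_continuous/derivable1_diffP.
  exact: (@ex_derive _ _ _ _ _ _ _ (Dc t Ot)).
- by move=> s t Ot; apply: is_derive_scale_direction; exact: Dc.
- move=> s; apply: Ck_mx => // a b.
  have H : Ck k O (fun t => s * w t a b) by apply: CkM => //; [exact: Ck_cst|exact: Ck_coord].
  by apply: Ck_eq H => // t _; rewrite mxE.
Qed.

Lemma near_eq_derive1 (V : normedModType R) (f h : R -> V) (O : set R) t :
  open O -> (forall s, O s -> f s = h s) -> O t -> derive1 f t = derive1 h t.
Proof.
move=> oO fh Ot; rewrite !derive1E; apply: near_eq_derive.
have : \forall s \near t, O s by exact: open_nbhs_nbhs.
by apply: filterS.
Qed.

End CurveRegularity.

(** The left-hand side is the derivative of g(w,w) along a geodesic. Metricity expresses the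
    derivative of [g] by [Lw], and the geodesic equation, in the form [w *m Lw = - w'], cancels it
    against the derivatives of [w]. *)
Lemma metric_norm_derivative (R : comNzRingType) n (g : 'M[R]_n) (dg : 'I_n -> 'M[R]_n)
    (S : 'I_n -> 'I_n -> 'I_n -> R) (w : 'rV[R]_n) :
  g^T = g ->
  (forall m, let L := \matrix_(a, c) S c m a in dg m = L *m g + g *m L^T) ->
  let w' := - acceleration_form S w 0 in
  (w' *m g + w *m \sum_a w 0 a *: dg a) *m w^T + w *m g *m w'^T = 0.
Proof.
move=> gs dgE w'; pose L m : 'M[R]_n := \matrix_(a, c) S c m a.
pose Lw := \sum_m w 0 m *: L m.
have wL : w *m Lw = - w'.
  rewrite /w' opprK /Lw; apply/rowP => c; rewrite !mxE add0r exchange_big/=.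
  apply: eq_bigr => a _; rewrite summxE mulr_sumr; apply: eq_bigr => m _.
  by rewrite !mxE; ring.
have -> : \sum_a w 0 a *: dg a = Lw *m g + g *m Lw^T.
  rewrite /Lw mulmx_suml [(\sum_m _)^T]linear_sum mulmx_sumr -big_split/=.
  apply: eq_bigr => m _; rewrite dgE -/(L m) scalerDr [(_ *: _)^T]linearZ/=.
  by rewrite scalemxAl scalemxAr.
rewrite mulmxDr !mulmxA wL !mulmxDl !mulNmx.
have -> : w *m g *m Lw^T *m w^T = - (w *m g *m w'^T).
  by rewrite -mulmxA -trmx_mul wL linearN mulmxN.
by rewrite addNKr addNr.
Qed.

(** * Light-like geodesics with prescribed initial velocity *)

Section LightLikeExistence.
Context {R : realType} {n : nat} {r : regularity} {M : manifold R n r}.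
Hypothesis r2 : at_least_C2 r.
Implicit Types (i j : atlas M) (g : metric M).

Local Notation tau i j := (transition (ch i) (ch j)).

(** Propagates the null condition from time 0: the derivative vanishes by [metric_norm_derivative],
    and the mean value theorem concludes. *)
Lemma norm_conserved g i (T : R) (c w : R -> 'rV[R]_n) :
  (forall t : R, `|t| < T -> [/\ img i (c t), is_derive t 1 c (w t) &
      is_derive t 1 w (- acceleration_form (levi_civita g i (c t)) (w t) 0)]) ->
  forall t, `|t| < T ->
    w t *m g i (c t) *m (w t)^T = w 0 *m g i (c 0) *m (w 0)^T.
Proof.
move=> H t tT; pose N s := w s *m g i (c s) *m (w s)^T.
have DN (s : R) : `|s| < T -> is_derive s 1 N 0.
  move=> sT; have [ci Dc Dw] := H s sT; have oi : open (img i) by exact: img_open.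
  have Dg : is_derive s 1 (fun y => g i (c y)) (\sum_a w s 0 a *: partial a (g i) (c s)).
    have := is_derive_comp_mx oi (metric_C1 r2 g i) ci (@ex_derive _ _ _ _ _ _ _ Dc).
    by rewrite (@derive_val _ _ _ _ _ _ _ Dc).
  have DD := is_derive_mulmx (is_derive_mulmx Dw Dg) (is_derive_trmx Dw).
  have E := @metric_norm_derivative R n (g i (c s)) (fun m => partial m (g i) (c s))
    (levi_civita g i (c s)) (w s) (gc_sym g ci) (fun m => levi_civita_metric r2 g m ci).
  exact: (eq_ind _ (is_derive s 1 N) DD _ E).
have DN00 (s : R) : `|s| <= `|t| -> is_derive s 1 (fun y => N y 0 0 : R) 0.
  move=> st; have DNs := DN s (le_lt_trans st tT).
  have dN : derivable N s 1 := @ex_derive _ _ _ _ _ _ _ DNs.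
  have E : 'D_1 (fun y => N y 0 0 : R) s = 0.
    rewrite -(derive_coord 0 0 dN) (@derive_val _ _ _ _ _ _ _ DNs); exact: mxE.
  by apply: DeriveDef => //; exact: (derivable_mxP N s 1).1 dN 0 0.
have [y _] := MVT_origin DN00; rewrite mul0r => /eqP; rewrite subr_eq0 => /eqP E.
by apply/matrixP => a b; rewrite !ord1.
Qed.

(** The equation is solved in the chart [i] alone; regularity, geodesic equation and null condition
    pass to any other chart by the transformation laws, velocities staying nonzero because the
    Jacobian is invertible. *)
Lemma light_like_geodesic_exists (G : connection M) g i x0 v :
  img i x0 -> v != 0 -> v *m g i x0 *m v^T = 0 ->
  exists J gamma, [/\ light_like_geodesic g J gamma, J 0, dom (ch i) (gamma 0),
    local_curve i gamma 0 = x0 & derive1 (local_curve i gamma) 0 = v].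
Proof.
move=> x0i v0 vnull.
have [T [c [w [T0 c0 w0 H]]]] := levi_civita_solution r2 g x0i v0.
pose J : set R := [set t | `|t| < T].
have oJ : open J.
  rewrite (_ : J = ball (0 : R) T); first exact: ball_open.
  by apply/seteqP; split=> t; rewrite /J -ball_normE /ball_/= sub0r normrN.
have ci t : J t -> img i (c t) by move=> /H[].
have wn t : J t -> w t != 0 by move=> /H[].
have Dc (t : R) : J t -> is_derive t 1 c (w t) by move=> /H[].
have Dw (t : R) : J t -> is_derive t 1 w (- acceleration_form (levi_civita g i (c t)) (w t) 0).
  by move=> /H[].
have contc (t : R) : J t -> {for t, continuous c}.
  move=> Jt; apply/differentiable_continuous/derivable1_diffP.
  exact: (@ex_derive _ _ _ _ _ _ _ (Dc t Jt)).
have contw (t : R) : J t -> {for t, continuous w}.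
  move=> Jt; apply/differentiable_continuous/derivable1_diffP.
  exact: (@ex_derive _ _ _ _ _ _ _ (Dw t Jt)).
have oi : open (img i) by exact: img_open.
have c2 : Ck 2 J c.
  suff w0' : Ck 0 J (fun t => - acceleration_form (levi_civita g i (c t)) (w t) 0).
    exact: (Ck_curve oJ Dc (Ck_curve oJ Dw w0')).
  have Ckc : Ck 0 J c by split.
  have Ckw : Ck 0 J w by split.
  apply: Ck_mx => // a l.
  have K : Ck 0 J (fun t => - \sum_a \sum_b levi_civita g i (c t) l a b * w t 0 a * w t 0 b).
    apply: CkN => //; apply: Ck_sum => // a' _; apply: Ck_sum => // b _.
    apply: CkM => //; last exact: Ck_coord.
    apply: CkM => //; last exact: Ck_coord.
    have LC0 : Ck 0 (img i) (fun x => levi_civita g i x l a' b).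
      by apply: levi_civita_Ck => //; case: (r).
    exact: (Ck_comp oJ oi ci Ckc LC0).
  by apply: Ck_eq K => // t _; rewrite ord1 mxE [X in _ = - X]mxE mxE add0r.
have dc t : J t -> derive1 c t = w t.
  by move=> Jt; rewrite derive1E; exact: (@derive_val _ _ _ _ _ _ _ (Dc t Jt)).
have ddc t : J t -> derive1 (derive1 c) t = - acceleration_form (levi_civita g i (c t)) (w t) 0.
  move=> Jt; apply: etrans (near_eq_derive1 oJ dc Jt) _.
  by rewrite derive1E; exact: (@derive_val _ _ _ _ _ _ _ (Dw t Jt)).
have acc0 t : J t -> coord_acceleration (levi_civita g) i c t = 0.
  move=> Jt; apply: etrans (congr2 (acceleration_form _) (dc t Jt) (ddc t Jt)) _.
  apply/rowP => l; rewrite mxE [X in X + _]mxE [X in - X + _]mxE [X in - (X + _) + _]mxE.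
  by rewrite add0r addNr [RHS]mxE.
pose gamma t := point (ch i) (c t).
(* The times at which the curve built in the chart [i] is visible in the chart [j]; openness is what
   allows differentiating there. *)
pose O j : set R := J `&` c @^-1` overlap (ch i) (ch j).
have oO j : open (O j) by apply: open_preimage_in => //; exact: open_overlap.
have OE j t : J t -> dom (ch j) (gamma t) -> O j t.
  by move=> Jt dj; split => //; apply/overlapP; split => //; exact: ci.
have cO2 j : Ck 2 (O j) c by apply: Ck_subset c2 => t [].
have vel j t : O j t -> derive1 (local_curve j gamma) t = w t *m jac i j (c t).
  move=> [Jt ot]; have Dct := @ex_derive _ _ _ _ _ _ _ (Dc t Jt).
  rewrite -(dc t Jt) derive1E.
  exact: (@derive_val _ _ _ _ _ _ _ (is_derive_transition_curve r2 Dct ot)).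
have local_i t : J t -> local_curve i gamma t = c t.
  by move=> Jt; apply: coord_point; exact: ci.
have J0 : J 0 by rewrite /J/= normr0.
exists J, gamma; split; [|exact: J0| | | ].
- split; [split|].
  + split; [exact: oJ| | | ].
    * move=> s t Js Jt u /andP[su ut]; move: Js Jt; rewrite /J/= !ltr_norml.
      by move=> /andP[s1 s2] /andP[t1 t2]; rewrite (lt_le_trans s1)// (le_lt_trans ut).
    * move=> t Jt; apply: continuous_comp; first exact: contc.
      by apply: point_continuous; exact: ci.
    * move=> j; split.
        have S : (J `&` gamma @^-1` dom (ch j)) `<=` O j by move=> t [Jt]; exact: OE.
        apply: Ck_subset S _.
        by apply: Ck_comp_rV (cO2 j) (transition_C2 r2 i j) => //;
          [exact: open_overlap|move=> t []].
      move=> t Jt dj; have Ot := OE j t Jt dj; rewrite vel//.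
      have Ju : jac i j (c t) \in unitmx by apply: (jac_unit g); case: Ot.
      apply: contraNN (wn t Jt) => /eqP E.
      by rewrite -(mulmxK Ju (w t)) E mul0mx.
  (* The solution is affinely parametrized, so the factor is 0 in every chart. *)
  + move=> t Jt; exists 0 => j dj; rewrite scale0r.
    have Ot := OE j t Jt dj.
    apply: etrans (coord_acceleration_law r2 (levi_civita_law r2 G g) (oO j) (cO2 j) Ot _) _.
      by move=> s [].
    by rewrite acc0// mul0mx.
  + move=> j t Jt dj /=; have [_ ot] := OE j t Jt dj; rewrite vel//.
    have -> : local_curve j gamma t = tau i j (c t) by [].
    have := norm_conserved (fun s sT => let: And4 h1 _ h2 h3 := H s sT in And3 h1 h2 h3) Jt.
    rewrite c0 w0 vnull => {1}<-; rewrite (gc_law g ot) trmx_mul !mulmxA.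
    by [].
- by rewrite /gamma c0; exact: dom_point.
- by rewrite local_i.
- by rewrite (near_eq_derive1 oJ local_i J0) dc.
Qed.

End LightLikeExistence.

(** * The Weyl form of the difference tensor *)

Section TensorForm.
Context {R : realFieldType} {n : nat}.
Implicit Types (g J : 'M[R]_n) (D : 'I_n -> 'M[R]_n) (psi xi : 'rV[R]_n).

(** For each upper index [m], the matrix of the bilinear form sending u, w to component [m] of
    psi(u) w + psi(w) u - g(u,w) xi. *)
Definition cone_form g D psi xi : Prop :=
  forall m, D m = ('e_m)^T *m psi + psi^T *m 'e_m - xi 0 m *: g.

Lemma cone_formE g D psi xi m a b : cone_form g D psi xi ->
  D m a b = (m == a)%:R * psi 0 b + (m == b)%:R * psi 0 a - g a b * xi 0 m.
Proof.
by move=> ->; rewrite !mxE !big_ord1 !mxE !eqxx/= ![_ == m]eq_sym mulrC [xi 0 m * _]mulrC;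
  congr (_ + _ - _); rewrite mulrC.
Qed.

Definition first_trace D : 'rV[R]_n := \row_k \sum_l D l l k.

Definition second_trace g D : 'rV[R]_n :=
  (\row_l \sum_j \sum_k invmx g j k * D l j k) *m g.

(** With phi = [xi *m g] the traces are t1 = (n+1) psi - phi and t2 = 2 psi - n phi. Eliminating
    psi, 2 t1 - (n+1) t2 = (n(n+1) - 2) phi, and n(n+1) - 2 = (n+2)(n-1). *)
Definition trace_phi g D : 'rV[R]_n :=
  ((n%:R + 2) * (n%:R - 1))^-1 *: (2 *: first_trace D - (n%:R + 1) *: second_trace g D).

Definition trace_psi g D : 'rV[R]_n := (n%:R + 1)^-1 *: (first_trace D + trace_phi g D).

Lemma sum_kron (F : 'I_n -> R) m : \sum_a (m == a)%:R * F a = F m.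
Proof.
rewrite (bigD1 m)//= eqxx mul1r big1 ?addr0// => a am.
by rewrite eq_sym (negPf am) mul0r.
Qed.

Lemma first_traceE g D psi xi : cone_form g D psi xi ->
  first_trace D = (n%:R + 1) *: psi - xi *m g.
Proof.
move=> DE; apply/rowP => k; rewrite !mxE.
under eq_bigr => l _ do rewrite (cone_formE _ _ _ DE) eqxx mul1r.
rewrite sumrB big_split/= sumr_const card_ord.
have -> : \sum_(l < n) (l == k)%:R * psi 0 l = psi 0 k.
  by rewrite -[RHS](sum_kron (psi 0)); apply: eq_bigr => l _; rewrite eq_sym.
congr (_ - _); first by rewrite mulrDl mul1r mulr_natl.
by apply: eq_bigr => l _; rewrite mulrC.
Qed.

Lemma second_traceE g D psi xi : g \in unitmx -> g^T = g -> cone_form g D psi xi ->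
  second_trace g D = 2 *: psi - n%:R *: (xi *m g).
Proof.
move=> gu gs DE.
have isym : (invmx g)^T = invmx g by rewrite trmx_inv gs.
have E : \row_l (\sum_j \sum_k invmx g j k * D l j k) =
    2 *: (psi *m invmx g) - n%:R *: xi.
  apply/rowP => l; rewrite [LHS]mxE.
  transitivity (\sum_j ((l == j)%:R * (\sum_k invmx g j k * psi 0 k)) +
     \sum_j (psi 0 j * \sum_k (l == k)%:R * invmx g j k) -
     xi 0 l * \sum_j \sum_k invmx g j k * g k j).
    rewrite mulr_sumr -big_split/= -sumrB; apply: eq_bigr => j _.
    rewrite !mulr_sumr -big_split/= -sumrB; apply: eq_bigr => k _.
    rewrite (cone_formE _ _ _ DE); have -> : g k j = g j k by rewrite -[in LHS]gs mxE.
    ring.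
  rewrite sum_kron; under [X in _ + X - _]eq_bigr => j _ do rewrite sum_kron.
  have -> : \sum_j \sum_k invmx g j k * g k j = n%:R.
    transitivity (\tr (invmx g *m g)); first by apply: eq_bigr => j _; rewrite mxE.
    by rewrite mulVmx// mxtrace1.
  have -> : \sum_k invmx g l k * psi 0 k = (psi *m invmx g) 0 l.
    by rewrite mxE; apply: eq_bigr => k _; rewrite mulrC -[in LHS]isym mxE.
  have -> : \sum_j psi 0 j * invmx g j l = (psi *m invmx g) 0 l by rewrite mxE.
  move: (psi *m invmx g) => u; rewrite !mxE; ring.
by rewrite /second_trace E mulmxBl -!scalemxAl mulmxKV.
Qed.

Lemma cone_form_traces g D psi xi : (2 < n)%N -> g \in unitmx -> g^T = g ->
  cone_form g D psi xi -> trace_phi g D = xi *m g /\ trace_psi g D = psi.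
Proof.
move=> n3 gu gs DE.
have n3R : 3 <= n%:R :> R by rewrite ler_nat.
have Ephi : trace_phi g D = xi *m g.
  rewrite /trace_phi (first_traceE DE) (second_traceE gu gs DE).
  move: (xi *m g) => phi; apply/rowP => k; rewrite !mxE; field.
  by apply/andP; split; apply: lt0r_neq0; lra.
split=> //; rewrite /trace_psi Ephi (first_traceE DE) subrK scalerA mulVf ?scale1r//.
Qed.

(** The form is natural: psi is pulled back as a covector and xi as a vector. Together with the
    uniqueness of the pair, this yields the laws of psi and phi without transforming any trace. *)
Lemma cone_form_pullback J gi gj (Di Dj : 'I_n -> 'M[R]_n) psi xi :
  J \in unitmx -> gi = J *m gj *m J^T ->
  (forall l a b, \sum_c Di c a b * J c l = \sum_d \sum_e Dj l d e * J a d * J b e) ->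
  cone_form gj Dj psi xi -> cone_form gi Di (psi *m J^T) (xi *m invmx J).
Proof.
move=> Ju gE law DE m.
have lawM l : \sum_c J c l *: Di c = J *m Dj l *m J^T.
  apply/matrixP => a b; rewrite summxE mxE.
  transitivity (\sum_c Di c a b * J c l); first by apply: eq_bigr => c _; rewrite mxE mulrC.
  rewrite law exchange_big/=; apply: eq_bigr => e _; rewrite !mxE mulr_suml.
  by apply: eq_bigr => d _; ring.
have -> : Di m = \sum_l invmx J l m *: (J *m Dj l *m J^T).
  under eq_bigr do rewrite -lawM scaler_sumr; rewrite exchange_big/=.
  transitivity (\sum_c ((J *m invmx J) c m) *: Di c).
    rewrite mulmxV// (bigD1 m)//= mxE eqxx scale1r big1 ?addr0// => c cm.
    by rewrite mxE (negPf cm) scale0r.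
  apply: eq_bigr => c _; rewrite mxE scaler_suml; apply: eq_bigr => l _.
  by rewrite scalerA mulrC.
have eJ : \sum_l invmx J l m *: (J *m ('e_l : 'rV[R]_n)^T) = ('e_m)^T.
  apply/colP => a; rewrite summxE.
  have := congr1 (fun A : 'M[R]_n => A a m) (mulmxV Ju); rewrite mxE mxE => E.
  rewrite !mxE !eqxx/= -E; apply: eq_bigr => l _; rewrite mxE mulrC; congr (_ * _).
  rewrite mxE (bigD1 l)//= big1 ?addr0 => [|k kl]; rewrite !mxE !eqxx/= ?mulr1//.
  by rewrite (negPf kl) mulr0.
under eq_bigr => l _.
  rewrite DE mulmxBr mulmxBl mulmxDr mulmxDl scalerBr scalerDr.
  rewrite -scalemxAr -scalemxAl -gE.
  over.
rewrite sumrB big_split/=; congr (_ + _ - _).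
- rewrite -eJ mulmx_suml; apply: eq_bigr => l _.
  by rewrite -scalemxAl !mulmxA.
- rewrite trmx_mul trmxK -[ 'e_m in RHS]trmxK -eJ linear_sum mulmx_sumr.
  apply: eq_bigr => l _; rewrite linearZ/= -scalemxAr trmx_mul trmxK.
  by rewrite !mulmxA.
- rewrite mxE scaler_suml; apply: eq_bigr => l _.
  by rewrite scalerA mulrC.
Qed.

End TensorForm.

(** The inhomogeneous term [H] is common to both laws and cancels, so the difference of two
    connections is a tensor. *)
Lemma difference_law (R : comNzRingType) n (J : 'M[R]_n) (Si Sj Ti Tj : 'I_n -> 'I_n -> 'I_n -> R)
    (H : 'I_n -> 'I_n -> 'I_n -> R) :
  (forall l a b, \sum_c Si c a b * J c l = H l a b + \sum_d \sum_e Sj l d e * J a d * J b e) ->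
  (forall l a b, \sum_c Ti c a b * J c l = H l a b + \sum_d \sum_e Tj l d e * J a d * J b e) ->
  forall l a b, \sum_c (Si c a b - Ti c a b) * J c l =
    \sum_d \sum_e (Sj l d e - Tj l d e) * J a d * J b e.
Proof.
move=> HS HT l a b; under eq_bigr do rewrite mulrBl.
rewrite sumrB HS HT opprD addrACA subrr add0r -sumrB; apply: eq_bigr => d _.
by rewrite -sumrB; apply: eq_bigr => e _; ring.
Qed.

(** * Changing a connection by a 1-form within its projective class *)

Section ProjectiveChange.
Context {R : realType} {n : nat} {r : regularity} {M : manifold R n r}.
Hypothesis r2 : at_least_C2 r.
Implicit Types (i j : atlas M) (chi : one_form M).

Local Notation tau i j := (transition (ch i) (ch j)).

Lemma velocity_law i j (gamma : R -> M) (t : R) : {for t, continuous gamma} ->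
  dom (ch i) (gamma t) -> dom (ch j) (gamma t) ->
  derivable (local_curve i gamma) t 1 ->
  derive1 (local_curve j gamma) t =
  derive1 (local_curve i gamma) t *m jac i j (local_curve i gamma t).
Proof.
move=> cg di dj Dg.
have ot : overlap (ch i) (ch j) (local_curve i gamma t) by exists (gamma t).
have H := is_derive_transition_curve r2 Dg ot.
apply: etrans (derive1E _ _) (etrans _ (@derive_val _ _ _ _ _ _ _ H)).
apply: near_eq_derive.
have : \forall s \near t, dom (ch i) (gamma s).
  by apply: cg; apply: open_nbhs_nbhs; split => //; exact: dom_open.
by apply: filterS => s ds; rewrite /local_curve /transition /= coordK.
Qed.

Lemma acceleration_form_kron (S : 'I_n -> 'I_n -> 'I_n -> R) (chi w w' : 'rV[R]_n) (s : R) :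
  acceleration_form (fun l a b =>
    S l a b + s * (kron R l a * chi 0 b + kron R l b * chi 0 a)) w w' =
  acceleration_form S w w' + (2 * s * \sum_a chi 0 a * w 0 a) *: w.
Proof.
apply/rowP => l; rewrite !mxE -addrA; congr (_ + _).
transitivity (\sum_a \sum_b S l a b * w 0 a * w 0 b +
   s * (\sum_a ((l == a)%:R * (w 0 a * \sum_b chi 0 b * w 0 b)) +
        \sum_a (chi 0 a * w 0 a * \sum_b (l == b)%:R * w 0 b))).
  rewrite -big_split/= mulr_sumr -big_split/=; apply: eq_bigr => a _.
  rewrite !mulr_sumr -big_split/= mulr_sumr -big_split/=; apply: eq_bigr => b _.
  by rewrite /kron; ring.
congr (_ + _); rewrite sum_kron; under [X in _ + X]eq_bigr do rewrite sum_kron.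
by rewrite -mulr_suml; ring.
Qed.

(** The change adds to the acceleration a multiple of the velocity, hence only alters the factor.
    The scalar [s] gives both directions of the equivalence: 1 for the change, -1 for its
    inverse. *)
Lemma geodesic_projective_change (S S' : symbols M) chi (s : R) J gamma :
  (forall i x l a b, S' i x l a b = S i x l a b +
     s * (kron R l a * chi i x 0 b + kron R l b * chi i x 0 a)) ->
  geodesic S J gamma -> geodesic S' J gamma.
Proof.
move=> SE [gr gg]; split => // t Jt; have [oJ _ cg Cg] := gr.
have [lam Hlam] := gg t Jt; have [i0 d0] := ch_cover (gamma t).
pose c i := local_curve i gamma.
(* In [geodesic] the factor is chosen before the chart; the value of [chi] on the velocity is
   therefore taken in a fixed chart [i0] and then shown to be the same in all others. *)
exists (lam + 2 * s * \sum_a chi i0 (c i0 t) 0 a * derive1 (c i0) t 0 a) => i di.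
have -> : acceleration S' i gamma t =
   acceleration_form (fun l a b => S i (c i t) l a b + s * (kron R l a * chi i (c i t) 0 b +
     kron R l b * chi i (c i t) 0 a)) (derive1 (c i) t) (derive1 (derive1 (c i)) t).
  congr (acceleration_form _ _ _); apply/funext => l; apply/funext => a; apply/funext => b.
  exact: SE.
apply: etrans (acceleration_form_kron _ _ _ _ _) _.
have -> : acceleration_form (S i (c i t)) (derive1 (c i) t) (derive1 (derive1 (c i)) t) =
   lam *: derive1 (c i) t by exact: Hlam.
rewrite -scalerDl.
suff E : \sum_a chi i (c i t) 0 a * derive1 (c i) t 0 a =
    \sum_a chi i0 (c i0 t) 0 a * derive1 (c i0) t 0 a.
  exact: (congr1 (fun z => (lam + 2 * s * z) *: derive1 (c i) t) E).
have Dc0 : derivable (local_curve i0 gamma) t 1.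
  by have [c2 _] := Cg i0; exact: (CkS_derivable (1 : R) c2 (conj Jt d0)).
have V := velocity_law (cg t Jt) d0 di Dc0.
have o0 : overlap (ch i0) (ch i) (c i0 t) by exists (gamma t).
have T0 : tau i0 i (c i0 t) = c i t by rewrite /transition /c /local_curve /= coordK.
have := fun a => fc_law chi a o0; rewrite T0.
move: V; rewrite -/(c i) -/(c i0); move: (derive1 (c i) t) (derive1 (c i0) t) => w w0.
move: (chi i (c i t)) (chi i0 (c i0 t)) (jac i0 i (c i0 t)) => p p0 A -> Hp.
transitivity (\sum_a \sum_b p 0 a * w0 0 b * A b a).
  by apply: eq_bigr => a _; rewrite mxE mulr_sumr; apply: eq_bigr => b _; rewrite mulrA.
rewrite exchange_big/=; apply: eq_bigr => b _; rewrite Hp mulr_suml.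
by apply: eq_bigr => a _; ring.
Qed.

(** The factor 1 gives the symbols literally the shape of the preceding lemma with [s = 1]. *)
Definition projective_change_symbols (G : connection M) chi : symbols M :=
  fun i x l a b => cc G i x l a b +
    1 * (kron R l a * chi i x 0 b + kron R l b * chi i x 0 a).

Lemma projective_change_regular (G : connection M) chi i l a b :
  Cr (reg_sub r 2) (img i) (fun x => projective_change_symbols G chi i x l a b).
Proof.
apply/CrP => k kr; have oi : open (img i) by exact: img_open.
have Ckchi m : Ck k (img i) (fun x => chi i x 0 m : R).
  by apply: Ck_coord => //; apply: (CrP _ _ _).1 (fc_regular chi i) k kr.
apply: CkD => //; first by apply: (CrP _ _ _).1 (cc_regular G i l a b) k kr.
apply: CkM => //; first exact: Ck_cst.
by apply: CkD => //; apply: CkM => //; exact: Ck_cst.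
Qed.

Lemma projective_change_sym (G : connection M) chi i x l a b : img i x ->
  projective_change_symbols G chi i x l a b = projective_change_symbols G chi i x l b a.
Proof.
move=> xi; apply: (congr2 +%R (cc_sym G l a b xi)).
exact: (congr1 ( *%R 1) (addrC _ _)).
Qed.

(** The added term is a tensor, so it leaves the inhomogeneous part of the connection law
    unchanged. *)
Lemma kron_law (A : 'M[R]_n) (p q : 'rV[R]_n) (Si Sj : 'I_n -> 'I_n -> 'I_n -> R)
    (H : 'I_n -> 'I_n -> 'I_n -> R) :
  (forall a, p 0 a = \sum_c A a c * q 0 c) ->
  (forall l a b, \sum_c Si c a b * A c l = H l a b + \sum_d \sum_e Sj l d e * A a d * A b e) ->
  forall l a b,
  \sum_c (Si c a b + 1 * (kron R c a * p 0 b + kron R c b * p 0 a)) * A c l =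
  H l a b + \sum_d \sum_e
    (Sj l d e + 1 * (kron R l d * q 0 e + kron R l e * q 0 d)) * A a d * A b e.
Proof.
move=> pq law l a b.
have kronl c : \sum_d kron R d c * A d l = A c l.
  rewrite -(sum_kron (fun d => A d l) c); apply: eq_bigr => d _.
  by rewrite /kron eq_sym.
transitivity (\sum_c Si c a b * A c l + (p 0 b * \sum_c kron R c a * A c l +
    p 0 a * \sum_c kron R c b * A c l)).
  rewrite !mulr_sumr -!big_split/=; apply: eq_bigr => c _; ring.
rewrite law !kronl -addrA; congr (_ + _).
transitivity (\sum_d \sum_e Sj l d e * A a d * A b e +
   (\sum_d (l == d)%:R * (A a d * \sum_e A b e * q 0 e) +
    \sum_d (A a d * q 0 d * \sum_e (l == e)%:R * A b e))).
  congr (_ + _); rewrite sum_kron; under [X in _ = _ + X]eq_bigr do rewrite sum_kron.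
  by rewrite -mulr_suml -!pq mulrC [X in _ + X]mulrC; ring.
rewrite -!big_split/=; apply: eq_bigr => d _; rewrite !mulr_sumr -!big_split/=.
by apply: eq_bigr => e _; rewrite /kron; ring.
Qed.

Lemma projective_change_law (G : connection M) chi :
  transforms_as_connection (projective_change_symbols G chi).
Proof.
move=> i j x l a b xo.
exact: (kron_law (fun a => fc_law chi a xo) (fun l a b => cc_law G l a b xo)).
Qed.

Definition projective_change (G : connection M) chi : connection M :=
  Connection (projective_change_regular G chi) (projective_change_sym G chi)
    (projective_change_law G chi).

Lemma projective_change_equivalent (G : connection M) chi :
  projectively_equivalent G (projective_change G chi).
Proof.
move=> J gamma; split.
  by apply: (@geodesic_projective_change _ _ chi 1) => i x l a b.
apply: (@geodesic_projective_change _ _ chi (-1)) => i x l a b.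
by rewrite /= /projective_change_symbols; ring.
Qed.

End ProjectiveChange.

(** * The Weyl connection attached to a light cone compatible pair *)

Section WeylForm.
Context {R : realType} {n : nat} {r : regularity} {M : manifold R n r}.
Hypothesis r2 : at_least_C2 r.
Hypothesis n3 : (2 < n)%N.
Variables (g : metric M) (G : connection M).
Implicit Types (i j : atlas M).

Local Notation tau i j := (transition (ch i) (ch j)).

Definition difference_tensor i x (m : 'I_n) : 'M[R]_n :=
  \matrix_(a, b) (cc G i x m a b - levi_civita g i x m a b).

Lemma difference_tensorE i x m a b :
  difference_tensor i x m a b = cc G i x m a b - levi_civita g i x m a b.
Proof. exact: mxE. Qed.

Lemma difference_tensor_law i j x l a b : overlap (ch i) (ch j) x ->
  \sum_c difference_tensor i x c a b * jac i j x c l =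
  \sum_d \sum_e difference_tensor j (tau i j x) l d e * jac i j x a d * jac i j x b e.
Proof.
move=> xo; have := difference_law (fun l a b => cc_law G l a b xo)
  (fun l a b => levi_civita_law r2 G g l a b xo) l a b.
have Di := fun c => difference_tensorE i x c a b.
have Dj := fun d e => difference_tensorE j (tau i j x) l d e.
move=> E; apply: etrans (etrans E _).
  by apply: eq_bigr => c _; exact: (congr1 (fun z => z * _) (Di c)).
apply: eq_bigr => d _; apply: eq_bigr => e _.
exact: (congr1 (fun z => z * _ * _) (esym (Dj d e))).
Qed.

Definition weyl_phi i x : 'rV[R]_n := trace_phi (g i x) (difference_tensor i x).

Definition weyl_psi i x : 'rV[R]_n := trace_psi (g i x) (difference_tensor i x).

Lemma trace_regular i k : reg_le k (reg_sub r 2) ->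
  (forall a, Ck k (img i) (fun x => weyl_phi i x 0 a : R)) /\
  (forall a, Ck k (img i) (fun x => weyl_psi i x 0 a : R)).
Proof.
move=> kr; have oi : open (img i) by exact: img_open.
have gk a b : Ck k (img i) (fun x => g i x a b : R).
  apply: Ck_coord => //; apply: Ck_le (leqnSn k) _.
  by apply: (CrP _ _ _).1 (gc_regular g i) _ _; exact: reg_sub1.
have ik a b : Ck k (img i) (fun x => invmx (g i x) a b : R).
  by apply: Ck_invmx => // x xi; exact: gc_nondegenerate.
have Dk m a b : Ck k (img i) (fun x => difference_tensor i x m a b).
  have H : Ck k (img i) (fun x => cc G i x m a b - levi_civita g i x m a b).
    apply: CkB => //; first by apply: (CrP _ _ _).1 (cc_regular G i m a b) k kr.
    exact: levi_civita_Ck.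
  by apply: Ck_eq H => // x _; apply/esym; exact: difference_tensorE.
have t1 a : Ck k (img i) (fun x => first_trace (difference_tensor i x) 0 a : R).
  have H : Ck k (img i) (fun x => \sum_l difference_tensor i x l l a).
    by apply: Ck_sum.
  by apply: Ck_eq H => // x _; apply/esym; exact: mxE.
have t2 a : Ck k (img i) (fun x => second_trace (g i x) (difference_tensor i x) 0 a : R).
  have H : Ck k (img i) (fun x => \sum_l (\sum_j \sum_m invmx (g i x) j m *
     difference_tensor i x l j m) * g i x l a).
    apply: Ck_sum => // l _; apply: CkM => //; apply: Ck_sum => // j _.
    by apply: Ck_sum => // m _; apply: CkM.
  apply: Ck_eq H => // x _; apply/esym; apply: etrans (mxE _ _ _ _) _.
  by apply: eq_bigr => l _; congr (_ * _); exact: mxE.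
have phik a : Ck k (img i) (fun x => weyl_phi i x 0 a : R).
  have H : Ck k (img i) (fun x => ((n%:R + 2) * (n%:R - 1))^-1 *
    (2 * first_trace (difference_tensor i x) 0 a
     - (n%:R + 1) * second_trace (g i x) (difference_tensor i x) 0 a)).
    apply: CkM => //; first exact: Ck_cst.
    by apply: CkB => //; apply: CkM => //; exact: Ck_cst.
  apply: Ck_eq H => // x _; rewrite /weyl_phi /trace_phi.
  move: (first_trace _) (second_trace _ _) => u v; by rewrite !mxE.
split=> // a.
have H : Ck k (img i) (fun x => (n%:R + 1)^-1 *
    (first_trace (difference_tensor i x) 0 a + weyl_phi i x 0 a)).
  apply: CkM => //; first exact: Ck_cst.
  exact: CkD.
apply: Ck_eq H => // x _; rewrite /weyl_psi /trace_psi -/(weyl_phi i x).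
move: (first_trace _) (weyl_phi i x) => u v; by rewrite !mxE.
Qed.

Hypothesis gindef : indefinite g.
Hypothesis light_cone : forall J gamma, light_like_geodesic g J gamma -> geodesic G J gamma.

(** For nonzero [v], a light-like geodesic with initial velocity [v] satisfies both equations at
    time 0 with the same second derivative [w'], which cancels in the difference and leaves the
    factor [mu - lam]. *)
Lemma difference_tensor_cone i x (v : 'rV[R]_n) : img i x ->
  v *m g i x *m v^T = 0 ->
  exists lambda, forall m, (v *m difference_tensor i x m *m v^T) 0 0 = lambda * v 0 m.
Proof.
move=> xi vnull; have [->|v0] := eqVneq v 0.
  by exists 0 => m; rewrite !mul0mx mxE mul0r.
have [J [gamma [Hg J0 di cx dv]]] := light_like_geodesic_exists r2 G xi v0 vnull.
have [_ HG] := light_cone Hg; have [[_ HL] _] := Hg.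
have [lam /(_ i di) El] := HL 0 J0; have [mu /(_ i di) Em] := HG 0 J0.
pose w' := derive1 (derive1 (local_curve i gamma)) 0.
have {}El : acceleration_form (levi_civita g i x) v w' = lam *: v.
  by rewrite -{1}cx -{1}dv -[in RHS]dv.
have {}Em : acceleration_form (cc G i x) v w' = mu *: v.
  by rewrite -{1}cx -{1}dv -[in RHS]dv.
exists (mu - lam) => m.
have := congr1 (fun u : 'rV[R]_n => u 0 m) (congr2 (fun a b => a - b) Em El).
move: (levi_civita g i x) (cc G i x) (difference_tensorE i x m) {Em El} => L S.
move: (difference_tensor i x m) w' => D u DE; rewrite !mxE => E.
transitivity (\sum_a \sum_b S m a b * v 0 a * v 0 b - \sum_a \sum_b L m a b * v 0 a * v 0 b).
  rewrite exchange_big/= [X in _ - X]exchange_big/= -sumrB; apply: eq_bigr => b _.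
  rewrite !mxE -sumrB mulr_suml; apply: eq_bigr => a _; rewrite DE; ring.
by rewrite mulrBl -E; ring.
Qed.

Lemma difference_tensor_form i x : img i x ->
  exists psi xi, cone_form (g i x) (difference_tensor i x) psi xi.
Proof.
move=> xi; have [p [q [p0 q0 sig]]] := gindef xi.
apply: (cone_tensor n3 p0 q0 sig); last by move=> v; exact: difference_tensor_cone.
move=> m; apply/matrixP => a b; apply: etrans (mxE _ _ _ _) _.
rewrite !difference_tensorE; congr (_ - _); first exact: cc_sym.
exact: levi_civita_sym.
Qed.

Lemma weyl_form i x : img i x ->
  cone_form (g i x) (difference_tensor i x) (weyl_psi i x) (weyl_phi i x *m invmx (g i x)).
Proof.
move=> xi; have [psi [xi' H]] := difference_tensor_form xi.
have gu := gc_nondegenerate g xi.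
have [Ephi Epsi] := cone_form_traces n3 gu (gc_sym g xi) H.
by rewrite /weyl_psi Epsi /weyl_phi Ephi mulmxK.
Qed.

Lemma weyl_forms_law i j x : overlap (ch i) (ch j) x ->
  weyl_phi i x = weyl_phi j (tau i j x) *m (jac i j x)^T /\
  weyl_psi i x = weyl_psi j (tau i j x) *m (jac i j x)^T.
Proof.
move=> xo; have xi := overlap_img xo; have yj := transition_img xo.
have Ju := jac_unit g xo; have gE := gc_law g xo.
have H := cone_form_pullback Ju gE (fun l a b => difference_tensor_law l a b xo) (weyl_form yj).
have [Ephi Epsi] := cone_form_traces n3 (gc_nondegenerate g xi) (gc_sym g xi) H.
split; last exact: Epsi.
apply: etrans Ephi _; rewrite gE !mulmxA mulmxKV// mulmxKV//.
exact: gc_nondegenerate.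
Qed.

Lemma weyl_phi_regular i : Cr (reg_sub r 2) (img i) (weyl_phi i).
Proof.
apply/CrP => k kr; have oi : open (img i) by exact: img_open.
apply: Ck_mx => // a b; have [H _] := trace_regular i kr.
by rewrite ord1; exact: H.
Qed.

Lemma row_law_entries (A : 'M[R]_n) (p q : 'rV[R]_n) : p = q *m A^T ->
  forall a, p 0 a = \sum_c A a c * q 0 c.
Proof. by move=> -> a; rewrite mxE; apply: eq_bigr => c _; rewrite mxE mulrC. Qed.

Lemma weyl_phi_law i j x a : overlap (ch i) (ch j) x ->
  weyl_phi i x 0 a = \sum_c jac i j x a c * weyl_phi j (tau i j x) 0 c.
Proof. by move=> xo; apply: row_law_entries; have [] := weyl_forms_law xo. Qed.

Definition weyl_one_form : one_form M := OneForm weyl_phi_regular weyl_phi_law.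

Definition weyl_chi i x : 'rV[R]_n := weyl_phi i x - weyl_psi i x.

Lemma weyl_chi_regular i : Cr (reg_sub r 2) (img i) (weyl_chi i).
Proof.
apply/CrP => k kr; have oi : open (img i) by exact: img_open.
apply: Ck_mx => // a b; have [H1 H2] := trace_regular i kr.
rewrite ord1; have H := CkB oi (H1 b) (H2 b).
apply: Ck_eq H => // x _; rewrite /weyl_chi; move: (weyl_phi i x) (weyl_psi i x) => u v.
by rewrite !mxE.
Qed.

Lemma weyl_chi_law i j x a : overlap (ch i) (ch j) x ->
  weyl_chi i x 0 a = \sum_c jac i j x a c * weyl_chi j (tau i j x) 0 c.
Proof.
move=> xo; apply: row_law_entries; have [E1 E2] := weyl_forms_law xo.
by rewrite /weyl_chi E1 E2 mulmxBl.
Qed.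

Definition weyl_chi_form : one_form M := OneForm weyl_chi_regular weyl_chi_law.

Lemma raise_weyl_phi i x l :
  img i x -> raise g weyl_one_form i x l = (weyl_phi i x *m invmx (g i x)) 0 l.
Proof.
move=> xi; have is_sym : (invmx (g i x))^T = invmx (g i x).
  by rewrite trmx_inv (gc_sym g xi).
rewrite /raise /=; move: (weyl_phi i x) (invmx (g i x)) is_sym => u A As.
by rewrite mxE; apply: eq_bigr => m _; rewrite mulrC -[in LHS]As mxE.
Qed.

(** Raising [weyl_phi] gives back xi, so the term g xi of the difference tensor is the last term of
    the Weyl symbols, and what remains is the projective change by [weyl_chi]. *)
Lemma weyl_same_symbols :
  same_symbols (weyl_symbols g weyl_one_form) (projective_change G weyl_chi_form).
Proof.
move=> i x l a b xi; rewrite /weyl_symbols raise_weyl_phi//=.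
rewrite /projective_change_symbols /=.
have := cone_formE l a b (weyl_form xi); rewrite difference_tensorE.
move: (weyl_phi i x *m _) => xi'; rewrite /weyl_chi.
move: (weyl_phi i x) (weyl_psi i x) (levi_civita g i x l a b) (cc G i x l a b) => u v L S.
by move=> E; rewrite !mxE /kron -[S](subrK L) E; ring.
Qed.

End WeylForm.

Theorem mainTheorem2 (R : realType) (n : nat) (r : regularity)
    (M : manifold R n r) (C : conformal_structure M)
    (P : projective_structure M) :
  (3 <= n)%N ->
  at_least_C2 r ->
  (forall g : metric M, cclass C g -> indefinite g) ->
  light_cone_compatible P C ->
  weyl_compatible P C.
Proof.
move=> n3 r2 indef [g [Cg [G [PG lc]]]].
exists g; split => //.
have gi := indef g Cg.
exists (weyl_one_form r2 n3 gi lc), (projective_change G (weyl_chi_form r2 n3 gi lc)).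
split; first exact: weyl_same_symbols.
(* The class is presented by a base connection [G0], so membership passes from [G] to its projective
   change by transitivity. *)
have [G0 PE] := pclassP P; rewrite PE in PG *.
move=> J gamma; apply: iff_trans (PG J gamma) _.
exact: projective_change_equivalent.
Qed.
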